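(* Let $P$ be a finite bounded graded poset and let $\operatorname{Stell}(P)$ be its stellahedral transform. If $P$ is Eulerian, then $\operatorname{Stell}(P)$ is Eulerian. If $P$ is Cohen--Macaulay, then $\operatorname{Stell}(P)$ is Cohen--Macaulay. In particular, if $P$ is Gorenstein*, then $\operatorname{Stell}(P)$ is Gorenstein*.
   Context: A poset is bounded if it has a minimum $\widehat 0$ and a maximum $\widehat 1$; it is graded if in each interval all maximal chains have the same length; the rank function $\rho(s)$ is the length of any maximal chain from $\widehat 0$ to $s$, and $\rho_{st}=\rho(t)-\rho(s)$. Stellahedral transform: for a poset $P$ with minimum $\widehat 0$, $$\operatorname{Stell}(P)=\{(c,y): c=\{\widehat 0=c_0<c_1<\dots<c_k\}\text{ a chain in }P \ (k\ge 0),\ y\in P,\ c_k\le y\}\sqcup\{\widehat 1_{\operatorname{Stell}}\},$$ where $\widehat 1_{\operatorname{Stell}}$ is a maximum element and $(c,y)\le(c',y')$ if and only if $c\subseteq c'$ and $y\ge y'$ in $P$. A finite bounded graded poset is Eulerian if its Möbius function satisfies $\mu_{st}=(-1)^{\rho_{st}}$ for all $s\le t$. The order complex $\Delta(Q)$ of a poset $Q$ is the simplicial complex whose faces are the chains of $Q$. An open interval of $P$ is a subposet of the form $(s,t)=\{w: s<w<t\}$, $P_{<t}=\{w: w<t\}$ or $P_{>s}=\{w: s<w\}$, for some $s<t$ in $P$. $P$ is Cohen--Macaulay (over $\mathbb Q$) if for every open interval $J$ of $P$ one has $\widetilde H_i(\Delta(J);\mathbb Q)=0$ for all $i<\dim\Delta(J)$.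 A poset is Gorenstein* if it is both Eulerian and Cohen--Macaulay. *)

(* Defs.v *)
From HB Require Import structures.
From mathcomp Require Import all_boot all_order all_algebra.
Set Implicit Arguments.
Unset Strict Implicit.
Unset Printing Implicit Defensive.
Import Order.TTheory GRing.Theory Num.Theory.
Local Open Scope order_scope.

Section Chains.
Context {d : Order.disp_t} {P : finPOrderType d}.

Definition chain (c : {set P}) : bool :=
  [forall x in c, forall y in c, x >=< y].

(* c_0 < ... < c_k has length k; chains here need not be nonempty, and the
   empty one also gets length 0. *)
Definition chain_length (c : {set P}) : nat := #|c|.-1.

Definition closed_interval (s t : P) : {set P} := [set w | s <= w <= t].

Definition maximal_chain (A c : {set P}) : bool :=
  maxset (fun c' : {set P} => (c' \subset A) && chain c') c.

End Chains.

Definition graded {d : Order.disp_t} (P : finPOrderType d) : Prop :=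
  forall (s t : P) (c c' : {set P}), s <= t ->
    maximal_chain (closed_interval s t) c ->
    maximal_chain (closed_interval s t) c' ->
    chain_length c = chain_length c'.

(* In a graded poset all the terms of the maximum are equal. *)
Definition rank {d : Order.disp_t} {P : finBPOrderType d} (s : P) : nat :=
  (\max_(c : {set P} | maximal_chain (closed_interval \bot s) c)
     chain_length c)%N.

Section Mobius.
Context {d : Order.disp_t} {P : finPOrderType d}.

Fixpoint mobius_rec (n : nat) (s t : P) : int :=
  if s == t then 1%R else
  if n is n'.+1 then (- \sum_(u : P | (s <= u < t)%O) mobius_rec n' s u)%R
  else 0%R.

(* The fuel #|P| is enough: see [mobius_xx] and [mobius_neq]. *)
Definition mobius (s t : P) : int := mobius_rec #|P| s t.

Lemma mobius_rec_stable (n m : nat) (s t : P) :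
  (#|[set u : P | (s <= u < t)%O]| <= n)%N ->
  (#|[set u : P | (s <= u < t)%O]| <= m)%N ->
  mobius_rec n s t = mobius_rec m s t.
Proof.
have card0 (t' : P) (F : P -> int) :
    (#|[set u : P | (s <= u < t')%O]| <= 0)%N ->
    (\sum_(u : P | (s <= u < t')%O) F u = 0)%R.
  rewrite leqn0 cards_eq0 => /eqP e; apply: big1 => u us.
  by have := in_set0 u; rewrite -e inE us.
have dec (t' u : P) : s <= u < t' ->
    (#|[set v : P | (s <= v < u)%O]|
       < #|[set v : P | (s <= v < t')%O]|)%N.
  move=> /andP[su ut]; apply: proper_card; apply/properP; split.
    apply/subsetP => v; rewrite !inE => /andP[-> /= vu].
    exact: lt_trans vu ut.
  by exists u; rewrite !inE ?su ?ut //= ltxx.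
elim: n m t => [|n IHn] [|m] t //= hn hm; case: eqP => // _.
- by rewrite card0 // oppr0.
- by rewrite card0 // oppr0.
congr (- _)%R; apply: eq_bigr => u us; apply: IHn.
- by have := leq_trans (dec _ _ us) hn.
- by have := leq_trans (dec _ _ us) hm.
Qed.

Lemma mobius_xx (s : P) : mobius s s = 1%R.
Proof. by rewrite /mobius; case: #|P| => [|n] /=; rewrite eqxx. Qed.

Lemma mobius_neq (s t : P) : s != t ->
  mobius s t = (- \sum_(u : P | (s <= u < t)%O) mobius s u)%R.
Proof.
move=> neq; rewrite /mobius (@mobius_rec_stable #|P| #|P|.+1) ?max_card //.
  by rewrite /= (negbTE neq).
by apply: leqW; apply: max_card.
Qed.

End Mobius.

Definition Eulerian {d : Order.disp_t} (P : finTBPOrderType d) : Prop :=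
  graded P /\
  forall s t : P, s <= t -> mobius s t = ((- 1) ^+ (rank t - rank s)%N)%R.

(* A complex K is given by its set of faces, the empty face included.  The
   vertices are elements of a poset and every face is meant to be a chain, so
   that each face carries the orientation v_0 < ... < v_k. *)
Section Homology.
Context {d : Order.disp_t} {P : finPOrderType d}.
Implicit Types (K : {set {set P}}) (F : {set P}).
Local Open Scope ring_scope.

Definition face_dim F : int := #|F|%:Z - 1.

(* dim {set0} = -1. *)
Definition complex_dim K : int := (\max_(F in K) #|F|)%N%:Z - 1.

Definition chain_space : vectType rat := {ffun {set P} -> rat^o}.

Definition face_vec F : chain_space := [ffun G => (G == F)%:R].

Definition face_boundary F : chain_space :=
  \sum_(x in F) (- 1) ^+ #|[set y in F | (y < x)%O]| *: face_vec (F :\ x).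

Definition boundary_fun (z : chain_space) : chain_space :=
  \sum_F (z F : rat) *: face_boundary F.

Lemma boundary_fun_is_linear : linear boundary_fun.
Proof.
move=> a u v; rewrite /boundary_fun scaler_sumr -big_split /=.
by apply: eq_bigr => F _; rewrite !ffunE scalerA -scalerDl.
Qed.

HB.instance Definition _ :=
  GRing.isLinear.Build rat chain_space chain_space *:%R boundary_fun
    boundary_fun_is_linear.

Definition boundary : 'End(chain_space) := linfun boundary_fun.

Lemma boundaryE (z : chain_space) :
  boundary z = \sum_F (z F : rat) *: face_boundary F.
Proof. by rewrite lfunE. Qed.

Definition chains K (i : int) : {vspace chain_space} :=
  <<[seq face_vec F | F <- enum K & face_dim F == i]>>%VS.

Definition cycles K (i : int) : {vspace chain_space} :=
  (chains K i :&: lker boundary)%VS.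

Definition boundaries K (i : int) : {vspace chain_space} :=
  (boundary @: chains K (i + 1))%VS.

(* The quotient of the i-cycles by the i-boundaries is zero. *)
Definition reduced_homology_vanishes K (i : int) : Prop :=
  (cycles K i <= boundaries K i)%VS.

Lemma boundary_face_vec F : boundary (face_vec F) = face_boundary F.
Proof.
rewrite boundaryE (bigD1 F) //= ffunE eqxx scale1r big1 ?addr0 // => G nG.
by rewrite ffunE (negbTE nG) scale0r.
Qed.

Lemma boundary_face_boundary F : chain F -> boundary (face_boundary F) = 0.
Proof.
move=> chF; pose s (x : P) (G : {set P}) := #|[set y in G | (y < x)%O]|.
have split_s x y : x \in F -> s y F = ((x < y)%O + s y (F :\ x))%N.
  move=> xF; rewrite /s (cardsD1 x) !inE xF; congr (_ + _)%N.
  by apply: eq_card => z; rewrite !inE andbA.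
rewrite /face_boundary linear_sum /=.
under eq_bigr => x _ do
  rewrite linearZ /= boundary_face_vec /face_boundary scaler_sumr.
pose t x y := (-1) ^+ s x F *: ((-1) ^+ s y (F :\ x) *: face_vec (F :\ x :\ y)).
have dec x : x \in F -> \sum_(y in F :\ x) t x y =
   \sum_(y in F) (if (y < x)%O then t x y else 0) +
   \sum_(y in F) (if (x < y)%O then t x y else 0).
  move=> xF; rewrite -big_split /= (bigD1 x (P := mem F)) //= ltxx addr0 add0r.
  apply: eq_big => [y|y]; first by rewrite !inE andbC.
  rewrite !inE => /andP[nyx yF].
  have : (x >=< y)%O by move/forall_inP: chF => /(_ _ xF) /forall_inP /(_ _ yF).
  by case/comparable_ltgtP=> [||e]; rewrite ?addr0 ?add0r //; rewrite e eqxx in nyx.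
rewrite (eq_bigr _ dec) big_split /= [X in _ + X]exchange_big /= -big_split /=.
apply: big1 => x xF; rewrite -big_split /=; apply: big1 => y yF.
case: ifP => [yx|_]; last by rewrite addr0.
rewrite /t (_ : F :\ y :\ x = F :\ x :\ y); last first.
  by apply/setP => z; rewrite !inE andbCA.
rewrite !scalerA -scalerDl -!exprD (split_s y x yF) yx (split_s x y xF).
rewrite lt_gtF // add0n add1n addSn exprS [(s y _ + s x _)%N]addnC mulN1r.
by rewrite addNr scale0r.
Qed.

End Homology.

Section CohenMacaulay.
Context {d : Order.disp_t}.

Definition order_complex {P : finPOrderType d} (J : {set P}) : {set {set P}} :=
  [set F : {set P} | (F \subset J) && chain F].

Lemma boundaries_sub_cycles {P : finPOrderType d} (J : {set P}) (i : int) :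
  (boundaries (order_complex J) i <= cycles (order_complex J) i)%VS.
Proof.
rewrite /boundaries /chains limg_span; apply/span_subvP => w /mapP[v /mapP[F]].
rewrite mem_filter mem_enum inE => /and3P[/eqP dF FJ chF] -> {v} -> {w}.
rewrite boundary_face_vec memv_cap memv_ker boundary_face_boundary // eqxx.
rewrite andbT; apply: rpred_sum => x xF; apply: rpredZ; apply: memv_span.
apply: map_f; rewrite mem_filter mem_enum inE; apply/and3P; split.
- by move: dF; rewrite /face_dim (cardsD1 x F) xF intS addrC addKr => ->;
     rewrite addrK.
- exact: subset_trans (subD1set _ _) FJ.
apply/forall_inP => y /setD1P[_ yF]; apply/forall_inP => z /setD1P[_ zF].
by move/forall_inP: chF => /(_ _ yF) /forall_inP /(_ _ zF).
Qed.

Definition is_open_interval {P : finPOrderType d} (J : {set P}) : Prop :=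
  exists s t : P, s < t /\
    [\/ J = [set w | s < w < t], J = [set w | w < t] | J = [set w | s < w]].

Definition CohenMacaulay (P : finPOrderType d) : Prop :=
  forall J : {set P}, is_open_interval J ->
  forall i : int, (i < complex_dim (order_complex J))%R ->
    reduced_homology_vanishes (order_complex J) i.

Definition Gorenstein_star (P : finTBPOrderType d) : Prop :=
  Eulerian P /\ CohenMacaulay P.

End CohenMacaulay.

Section StellDef.
Context {d : Order.disp_t} (P : finBPOrderType d).

Definition stell_pair (cy : {set P} * P) : bool :=
  [&& chain cy.1, \bot \in cy.1 & [forall x in cy.1, x <= cy.2]].

(* None is the added maximum. *)
Definition Stell : Type := option {cy : {set P} * P | stell_pair cy}.

HB.instance Definition _ := Finite.on Stell.

Definition stell_le (a b : Stell) : bool :=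
  match a, b with
  | _, None => true
  | None, Some _ => false
  | Some u, Some v =>
      ((val u).1 \subset (val v).1) && ((val v).2 <= (val u).2)
  end.

Lemma stell_le_refl : reflexive stell_le.
Proof. by case=> [u|] //=; rewrite subxx lexx. Qed.

Lemma stell_le_anti : antisymmetric stell_le.
Proof.
case=> [u|] [v|] //= /andP[/andP[s1 l1] /andP[s2 l2]].
congr Some; apply: val_inj; rewrite [LHS]surjective_pairing.
rewrite [RHS]surjective_pairing; congr pair.
  by apply/eqP; rewrite eqEsubset s1 s2.
by apply: le_anti; rewrite l2 l1.
Qed.

Lemma stell_le_trans : transitive stell_le.
Proof.
case=> [v|] [u|] [w|] //= /andP[s1 l1] /andP[s2 l2].
by rewrite (subset_trans s1 s2) (le_trans l2 l1).
Qed.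

HB.instance Definition _ := Order.Le_isPOrder.Build d Stell
  stell_le_refl stell_le_anti stell_le_trans.

Lemma stell_le_top (a : Stell) : a <= (None : Stell).
Proof. by case: a. Qed.

HB.instance Definition _ := Order.hasTop.Build d Stell stell_le_top.

End StellDef.

Section StellBottom.
Context {d : Order.disp_t} (P : finTBPOrderType d).

Lemma stell_bot_subproof : stell_pair ([set \bot], \top : P).
Proof.
apply/and3P; split; rewrite /= ?set11 //; last first.
  by apply/forall_inP => x _; apply: lex1.
apply/forall_inP => x /set1P ->; apply/forall_inP => y /set1P ->.
exact: comparablexx.
Qed.

Definition stell_bot : Stell P := Some (exist (@stell_pair d P) ([set \bot], \top) stell_bot_subproof).

Lemma stell_bot_le (a : Stell P) : stell_bot <= a.
Proof.
case: a => [[[c y] /= cyP]|] //; rewrite /Order.le /=.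
by case/and3P: (cyP) => /= _ c0 _; rewrite sub1set c0 lex1.
Qed.

HB.instance Definition _ := Order.hasBottom.Build d (Stell P) stell_bot_le.

End StellBottom.

(* Main.v *)
Require Import Defs.
From HB Require Import structures.
From mathcomp Require Import all_boot all_order all_algebra.
From mathcomp Require Import zify ring.

(** Let rho be the rank of P, and let n be the rank of its maximum.  The function
    sending (c, y) to (#|c| - 1) + (n - rho y), and the added maximum to n + 1,
    increases by exactly one along each covering relation of Stell P
    ([stell_rank_function]): a covering either adds one element to c, or moves y
    to an element that it covers, or goes to the maximum, and then c is a maximal
    chain of [\bot, y].  Hence Stell P is graded with this rank.

    Eulerian.  For a graded poset the condition says that (-1)^rank sums to zero
    over each interval [s, t] with s < t ([Eulerian_criterion]).  An interval
    [(c, y), (c', y')] of Stell P is the product of the Boolean lattice [c, c']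
    and of the dual of [y', y], so its sum factors and one factor vanishes.  For
    [(c, y), maximum], summing over the second component first leaves the chains
    containing c whose largest element is y; their signed number is -(-1)^rho(y)
    ([sum_chains_top], a form of Philip Hall's theorem).

    Cohen-Macaulay.  Since the coefficients form a field, the vanishing of the
    homology of an order complex below some dimension amounts to the existence of
    a contracting homotopy in these degrees ([acyclic_below]).  This form is easy
    to transport: explicit formulas give it for ordinal sums (joins of complexes,
    [acyclic_below_join]), under (anti-)isomorphisms, and when one adds or deletes
    an element x whose link is acyclic enough ([acyclic_below_add],
    [acyclic_below_remove]).  Deleting elements one by one, each with an acyclic
    link, plays the role of Quillen's fibre lemma ([delete_descending],
    [delete_ascending]).  The open intervals of Stell P are then treated so.

    - Below the maximum, an interval is the proper part of a product of a Boolean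
      lattice and of the dual of an interval of P.  If c = c', it is dual to an
      open interval of P.  Otherwise choose x in c' but not in c, and let p be the
      element (c + x, y).  Without p the interval is acyclic, so that
      it behaves like a suspension of the link of p, which is a smaller interval
      of the same kind ([acyclic_pair]).

    - An interval ((c, y), maximum) with y in c consists of the nonempty chains of
      the set of elements that refine c below y, hence it is the barycentric
      subdivision of the ordinal sum of the open intervals between consecutive
      elements of c ([acyclic_above_top]).  If y is not in c, the interval without
      (c + y, y) is acyclic, and the link of (c + y, y) is the interval
      ((c + y, y), maximum) of the first kind ([acyclic_above]).

    In each case the bound obtained is the difference of ranks minus one, which is
    the largest number of elements of a chain in the interval. *)

Set Implicit Arguments.
Unset Strict Implicit.
Unset Printing Implicit Defensive.
Import Order.TTheory GRing.Theory Num.Theory.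

(** * Chains in a finite poset *)

Section Chains.
Context {d : Order.disp_t} {T : finPOrderType d}.
Implicit Types (F G S c : {set T}) (x y : T).
Local Open Scope order_scope.

Lemma chainP F : reflect {in F &, forall x y, (x >=< y)%O} (chain F).
Proof.
apply: (iffP forall_inP) => [h x y xF yF|h x xF].
  by move/forall_inP: (h x xF) => /(_ _ yF).
by apply/forall_inP => y yF; apply: h.
Qed.

Lemma chain_sub F G : G \subset F -> chain F -> chain G.
Proof.
by move=> /subsetP s /chainP h; apply/chainP => x y /s xF /s yF; apply: h.
Qed.

Lemma exists_maximal S x0 : x0 \in S ->
  exists2 x, x \in S & {in S, forall y, ~~ (x < y)}.
Proof.
move=> x0S; case: (arg_maxnP (fun x => #|[set z | z <= x]|) x0S) => x xS xmax.
exists x => // y yS; apply/negP => xy; have /= := xmax y yS; rewrite leqNgt.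
move/negP; apply; apply: proper_card; apply/properP; split.
  by apply/subsetP => z; rewrite !inE => zx; apply: le_trans zx (ltW xy).
by exists y; rewrite !inE ?lexx // lt_geF.
Qed.

Lemma exists_minimal S x0 : x0 \in S ->
  exists2 x, x \in S & {in S, forall y, ~~ (y < x)}.
Proof.
move=> x0S; case: (arg_maxnP (fun x => #|[set z | x <= z]|) x0S) => x xS xmax.
exists x => // y yS; apply/negP => xy; have /= := xmax y yS; rewrite leqNgt.
move/negP; apply; apply: proper_card; apply/properP; split.
  by apply/subsetP => z; rewrite !inE => zx; apply: le_trans (ltW xy) zx.
by exists y; rewrite !inE ?lexx // lt_geF.
Qed.

Lemma chain_max F x0 : chain F -> x0 \in F ->
  exists2 m, m \in F & {in F, forall y, y <= m}.
Proof.
move=> cF /exists_maximal[m mF mmax]; exists m => // y yF.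
by have := mmax y yF; case/comparable_ltgtP: (chainP _ cF _ _ mF yF).
Qed.

Lemma chain_setU1 (F : {set T}) x : chain F -> {in F, forall y, x >=< y} ->
  chain (x |: F).
Proof.
move=> cF cx; apply/chainP => u v /setU1P[->|uF] /setU1P[->|vF].
- exact: comparablexx.
- exact: cx.
- by rewrite comparable_sym cx.
- exact: (chainP _ cF).
Qed.

Definition is_top y c := (y \in c) && [forall x in c, (x <= y)].

Lemma is_topP y c : reflect (y \in c /\ {in c, forall x, (x <= y)}) (is_top y c).
Proof. by apply: (iffP andP) => -[yc h]; split=> //; apply/forall_inP. Qed.

Lemma chain_top c x : chain c -> x \in c -> exists m, is_top m c /\
  forall y, is_top y c = (y == m).
Proof.
move=> cc xc; have [m mc mmax] := chain_max cc xc.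
have mt : is_top m c by apply/is_topP.
exists m; split=> // y; apply/idP/eqP => [/is_topP[yc ymax]|->//].
by apply: le_anti; rewrite mmax ?ymax.
Qed.

End Chains.

(** * Chain complexes and contracting homotopies *)

Definition lfun_simpE := (comp_lfunE, add_lfunE, opp_lfunE, id_lfunE, zero_lfunE).

Section LinearExtension.
Local Open Scope ring_scope.
Context {d : Order.disp_t} {T : finPOrderType d} {W : vectType rat}.
Implicit Types (g : {set T} -> W).

Definition extend_fun g (z : @chain_space d T) : W := \sum_F (z F : rat) *: g F.

Lemma extend_fun_is_linear g : linear (extend_fun g).
Proof.
move=> a u v; rewrite /extend_fun scaler_sumr -big_split /=.
by apply: eq_bigr => F _; rewrite !ffunE scalerA -scalerDl.
Qed.

HB.instance Definition _ g :=
  GRing.isLinear.Build rat (@chain_space d T) W *:%R (extend_fun g)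
    (extend_fun_is_linear g).

Definition extend g : 'Hom(@chain_space d T, W) := linfun (extend_fun g).

Lemma extendE g F : extend g (face_vec F) = g F.
Proof.
rewrite lfunE /= /extend_fun (bigD1 F) //= ffunE eqxx scale1r big1 ?addr0 //.
by move=> G nG; rewrite ffunE (negbTE nG) scale0r.
Qed.

End LinearExtension.

Section Contractions.
Local Open Scope ring_scope.
Context {d : Order.disp_t} {T : finPOrderType d}.
Implicit Types (J A B F G : {set T}) (x y : T) (n k : nat) (z : @chain_space d T).

Definition face J F := (F \subset J) && chain F.

(** The simplicial chains of dimension k - 1 of the order complex of J.  Counting
    vertices keeps degrees in nat, with the empty face in degree 0, and makes
    them add up in joins. *)
Definition kchains J k : {vspace @chain_space d T} :=
  chains (order_complex J) (k%:Z - 1).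

Lemma face_sub J F G : G \subset F -> face J F -> face J G.
Proof.
by move=> s /andP[FJ cF]; rewrite /face (subset_trans s FJ) (chain_sub s cF).
Qed.

Lemma face_kchains J F : face J F -> face_vec F \in kchains J #|F|.
Proof.
move=> fF; apply: memv_span; apply: map_f.
by rewrite mem_filter mem_enum inE /face_dim eqxx.
Qed.

(** The working principle for all identities between linear maps on chains: they
    only have to be checked on faces. *)
Lemma kchains_ind J k (Q : @chain_space d T -> Prop) :
  Q 0 ->
  (forall a F z, face J F -> #|F| = k -> Q z -> Q (a *: face_vec F + z)) ->
  forall z, z \in kchains J k -> Q z.
Proof.
move=> Q0 QS z; rewrite /kchains /chains.
have: forall F, F \in [seq F <- enum (order_complex J) | face_dim F == k%:Z - 1] ->
    face J F /\ #|F| = k.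
  move=> F; rewrite mem_filter mem_enum inE => /andP[/eqP /addIr [cF] fF].
  by split.
elim: [seq _ <- _ | _] z => [|F s IHs] z hs /=.
  by rewrite span_nil memv0 => /eqP ->.
rewrite span_cons => /memv_addP[u /vlineP[a ->] [v vs ->]].
have [fF cF] := hs F (mem_head _ _).
by apply: QS => //; apply: IHs => // G Gs; apply: hs; rewrite inE Gs orbT.
Qed.

Lemma kchains_mem (W : vectType rat) (U : {vspace W}) J k
    (f : 'Hom(@chain_space d T, W)) :
  (forall F, face J F -> #|F| = k -> f (face_vec F) \in U) ->
  forall z, z \in kchains J k -> f z \in U.
Proof.
move=> fU; apply: kchains_ind => [|a F z fF cF zU]; first by rewrite linear0 mem0v.
by rewrite linearP memvD //= memvZ // fU.
Qed.

Lemma kchains_eq (W : vectType rat) J k (f g : 'Hom(@chain_space d T, W)) :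
  (forall F, face J F -> #|F| = k -> f (face_vec F) = g (face_vec F)) ->
  forall z, z \in kchains J k -> f z = g z.
Proof.
move=> fg; apply: kchains_ind => [|a F z fF cF e]; first by rewrite !linear0.
by rewrite !linearP /= e fg.
Qed.

Lemma kchainsS J J' k : J \subset J' -> (kchains J k <= kchains J' k)%VS.
Proof.
move=> s; apply/subvP; apply: kchains_ind => [|a F z /andP[FJ cF] <- zJ].
  exact: mem0v.
rewrite memvD // memvZ // face_kchains // /face cF andbT.
exact: subset_trans FJ s.
Qed.

Lemma boundary_kchains J k z :
  z \in kchains J k.+1 -> boundary z \in kchains J k.
Proof.
apply: kchains_mem => F fF cF /=; rewrite boundary_face_vec.
apply: rpred_sum => x xF; apply: memvZ.
have [->] : k.+1 = #|F :\ x|.+1 by rewrite -cF (cardsD1 x) xF.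
by apply: face_kchains; apply: face_sub fF; apply: subD1set.
Qed.

Lemma boundary_kchains0 J z : z \in kchains J 0 -> boundary z = 0.
Proof.
move=> zJ; rewrite (@kchains_eq _ J 0 boundary 0%VF _ z zJ) ?lfunE //.
move=> F _ /cards0_eq -> /=; rewrite boundary_face_vec /face_boundary big_set0.
by rewrite lfunE.
Qed.

(** With the truncated predecessor, faces without vertices need no separate
    treatment in the homotopy formulas below. *)
Lemma boundary_kchains_pred J k z :
  z \in kchains J k -> boundary z \in kchains J k.-1.
Proof.
case: k => [|k]; last exact: boundary_kchains.
by move=> /boundary_kchains0 ->; apply: mem0v.
Qed.

Lemma boundaryK J k z : z \in kchains J k -> boundary (boundary z) = 0.
Proof.
move=> zJ; rewrite -[LHS]comp_lfunE.
rewrite (@kchains_eq _ J k (boundary \o boundary)%VF 0%VF _ z zJ) ?lfunE //.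
move=> F /andP[_ cF] _ /=; rewrite !lfunE.
by rewrite /= boundary_face_vec boundary_face_boundary.
Qed.

(** A contracting homotopy in the degrees of faces with fewer than n vertices.  It
    is required to raise the degree by one everywhere, also where it does not
    contract, so that homotopies can be composed without tracking their range. *)
Definition contraction n J (h : 'End(@chain_space d T)) :=
  forall k z, z \in kchains J k ->
    h z \in kchains J k.+1 /\
    ((k < n)%N -> boundary (h z) + h (boundary z) = z).

Definition acyclic_below n J := exists h, contraction n J h.

Definition acyclic J := forall n, acyclic_below n J.

Lemma acyclic_belowW m n J : (m <= n)%N -> acyclic_below n J -> acyclic_below m J.
Proof.
move=> mn [h hP]; exists h => k z /hP[zk e]; split=> // km.
by apply: e; apply: leq_trans mn.
Qed.

Lemma acyclic_below0 J : acyclic_below 0 J.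
Proof. by exists 0 => k z _; rewrite lfunE mem0v. Qed.

(** The homotopy is built degree by degree.  Where h is already known on smaller
    faces, F - h (boundary F) is a cycle, hence a boundary, and any preimage w of
    it can serve as the value of the homotopy on F. *)
Lemma vanishing_acyclic_below n J :
  (forall k, (k < n)%N -> reduced_homology_vanishes (order_complex J) (k%:Z - 1)) ->
  acyclic_below n J.
Proof.
elim: n => [|n IHn] van; first by exact: acyclic_below0.
have [|h hP] := IHn; first by move=> k kn; apply: van; apply: ltnW.
have key F : exists w, face J F && (#|F| == n) ->
    w \in kchains J n.+1 /\ boundary w = face_vec F - h (boundary (face_vec F)).
  have [/andP[fF /eqP cF]|_] := boolP (face J F && (#|F| == n)); last by exists 0.
  have Fn : face_vec F \in kchains J n by rewrite -cF face_kchains.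
  have bF : boundary (h (boundary (face_vec F))) = boundary (face_vec F).
    case: n Fn {cF van IHn} hP => [|m] Fn hP.
      by rewrite (boundary_kchains0 Fn) !linear0.
    have dF := boundary_kchains Fn.
    have [_ /(_ (ltnSn m))] := hP _ _ dF.
    by rewrite (boundaryK Fn) linear0 addr0.
  have hd : h (boundary (face_vec F)) \in kchains J n.
    case: n Fn {cF van IHn} hP => [|m] Fn hP.
      by rewrite (boundary_kchains0 Fn) !linear0 mem0v.
    by case: (hP _ _ (boundary_kchains Fn)).
  have: face_vec F - h (boundary (face_vec F)) \in cycles (order_complex J) (n%:Z - 1).
    rewrite memv_cap memv_ker linearB /= bF subrr eqxx andbT.
    by apply: memvB.
  move/(subvP (van n (ltnSn n))) => /memv_imgP[w wC ->]; exists w => _; split=> //.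
  by move: wC; rewrite subrK -[n%:Z](addrK (1 : int)) /kchains intS [1+_]addrC.
have [w wP] := fin_all_exists key.
pose g := extend (fun F => if (#|F| == n) then w F else
  if (#|F| < n)%N then h (face_vec F) else 0).
have gh k z : (k < n)%N -> z \in kchains J k -> g z = h z.
  move=> kn; apply: kchains_eq => F _ cF.
  by rewrite extendE cF kn (ltn_eqF kn).
exists g => k z zk; split.
  move: z zk; apply: kchains_mem => F fF cF; rewrite extendE cF.
  case: eqP => [kn|_].
    by case: (wP F); rewrite ?fF ?cF kn ?eqxx.
  case: ltnP => [kn|_]; last exact: mem0v.
  by have [] := hP k (face_vec F) _; rewrite -?cF ?face_kchains.
rewrite ltnS leq_eqVlt => /orP[/eqP kn|kn]; last first.
  rewrite (gh k) //; have [_ /(_ kn) {3}<-] := hP _ _ zk; congr (_ + _).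
  case: k kn zk => [|k] kn zk; first by rewrite (boundary_kchains0 zk) !linear0.
  by rewrite (gh k) ?(ltnW kn) // boundary_kchains.
have -> : g (boundary z) = h (boundary z).
  case: n kn hP {van IHn key wP} @g gh zk => [|n] -> hP g gh zk.
    by rewrite (boundary_kchains0 zk) !linear0.
  by rewrite (gh n) ?boundary_kchains.
have := @kchains_eq _ J k ((boundary \o g) + (h \o boundary))%VF \1%VF _ z zk.
rewrite !lfun_simpE => -> // F fF cF.
rewrite !lfun_simpE /= extendE cF kn eqxx.
by have [|_ ->] := wP F; rewrite ?fF ?cF ?kn ?eqxx // subrK.
Qed.

(** A cycle z satisfies z = boundary (h z). *)
Lemma acyclic_below_vanishing n J (i : int) : acyclic_below n J ->
  (i < n%:Z - 1)%R -> reduced_homology_vanishes (order_complex J) i.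
Proof.
move=> [h hP] i_n; apply/subvP => z /[!memv_cap] /andP[zi].
rewrite memv_ker => /eqP dz.
have [i_neg|i_ge] := ltrP i (-1).
  suff -> : z = 0 by exact: mem0v.
  move: zi; rewrite /chains (_ : [seq _ <- _ | _] = [::]) ?span_nil ?memv0.
    by move/eqP.
  apply/eqP; rewrite -size_eq0 size_filter -leqn0 leqNgt -has_count.
  apply/hasPn => F _; rewrite /face_dim; apply: contraTneq i_neg => <-.
  by rewrite -leNgt lerDr.
pose k := `|(i + 1)%R|%N.
have ik : i = k%:Z - 1 by rewrite gez0_abs ?addrK // -(addNr 1) lerD2r.
have kn : (k < n)%N by move: i_n; rewrite ik ltrD2r ltz_nat.
rewrite ik in zi *; have [hz /(_ kn)] := hP k z zi.
rewrite dz linear0 addr0 => <-; apply: memv_img.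
by move: hz; rewrite subrK /kchains intS [1 + _]addrC addrK.
Qed.

End Contractions.

(** * Adding and deleting a vertex *)

Section Removal.
Local Open Scope ring_scope.
Context {d : Order.disp_t} {T : finPOrderType d}.
Implicit Types (J A B F G : {set T}) (x y : T) (n k : nat) (z : @chain_space d T).

(** The sign with which x is removed from, or inserted into, a face. *)
Definition position_sign x G : rat := (-1) ^+ #|[set y in G | (y < x)%O]|.

(** The signed operation that inserts x in its place in the increasing order of
    the vertices; the sign makes it a cone operator ([boundary_cone]). *)
Definition cone x : 'End(@chain_space d T) :=
  extend (fun G => position_sign x G *: face_vec (x |: G)).

Definition link J x := [set y in J | (y < x)%O || (x < y)%O].

Lemma position_signK x G : position_sign x G * position_sign x G = 1.
Proof. by rewrite /position_sign -signr_odd; case: odd; rewrite ?mulrNN mulr1. Qed.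

Lemma link_sub J x : link J x \subset J :\ x.
Proof.
by apply/subsetP => y; rewrite !inE => /andP[-> ]; case: eqP => // ->; rewrite ltxx.
Qed.

Lemma face_link J x F : face J F -> x \in F -> face (link J x) (F :\ x).
Proof.
move=> /andP[FJ cF] xF; rewrite /face (chain_sub (subD1set _ _) cF) andbT.
apply/subsetP => y; rewrite !inE => /andP[yx yF]; rewrite (subsetP FJ) //=.
by have := chainP _ cF _ _ yF xF; case/comparable_ltgtP=> // e; rewrite e eqxx in yx.
Qed.

Lemma cone_face J x G : x \in J -> face (link J x) G -> face J (x |: G).
Proof.
move=> xJ /andP[GJ cG]; rewrite /face subUset sub1set xJ /=.
have -> /= : G \subset J.
  by apply: subset_trans (subset_trans GJ (link_sub _ _)) (subD1set _ _).
have lG y : y \in G -> (x >=< y)%O.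
  move/(subsetP GJ); rewrite !inE => /andP[_] /orP[yx|xy]; last exact: lt_comparable.
  by rewrite comparable_sym lt_comparable.
apply/chainP => u v /setU1P[->|uG] /setU1P[->|vG]; rewrite ?comparablexx ?lG //.
  by rewrite comparable_sym lG.
exact: (chainP _ cG).
Qed.

Lemma notin_link J x G : face (link J x) G -> x \notin G.
Proof.
by case/andP=> GJ _; apply/negP => /(subsetP (subset_trans GJ (link_sub _ _)));
  rewrite !inE eqxx.
Qed.

Lemma cone_kchains J x k z : x \in J ->
  z \in kchains (link J x) k -> cone x z \in kchains J k.+1.
Proof.
move=> xJ; apply: kchains_mem => G fG <-; rewrite extendE memvZ //.
have -> : #|G|.+1 = #|x |: G| by rewrite cardsU1 (notin_link fG).
by apply: face_kchains; apply: cone_face.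
Qed.

(** Removing x gives back the face.  For another vertex y, the two insertion signs
    differ by one transposition, because x and y are comparable: exactly one of
    them moves the position of the other. *)
Lemma boundary_cone J x k z : z \in kchains (link J x) k ->
  boundary (cone x z) = z - cone x (boundary z).
Proof.
have := @kchains_eq _ _ _ (link J x) k (boundary \o cone x)%VF
  (\1 - (cone x \o boundary))%VF.
move=> /(_ _ z); rewrite !lfun_simpE; apply=> G fG _; rewrite !lfun_simpE.
rewrite boundary_face_vec extendE linearZ /= boundary_face_vec.
have xG := notin_link fG.
rewrite {1}/face_boundary big_setU1 //= setU1K // scalerDr scalerA.
have -> : (-1) ^+ #|[set y in x |: G | (y < x)%O]| = position_sign x G.
  congr (_ ^+ _); apply: eq_card => y; rewrite !inE.
  by case: eqP => // ->; rewrite ltxx !andbF.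
rewrite position_signK scale1r; congr (_ + _).
rewrite /face_boundary scaler_sumr [cone x _]linear_sum /= -sumrN; apply: eq_bigr => y yG.
have yx : y != x by apply: contraNneq xG => <-.
rewrite [cone x _]linearZ /= extendE !scalerA -scaleNr.
have -> : (x |: G) :\ y = x |: (G :\ y).
  by apply/setP => u; rewrite !inE; case: (u =P x) => // ->; rewrite eq_sym yx.
congr (_ *: _).
have -> : position_sign x (G :\ y) = (-1) ^+ (y < x)%O * position_sign x G.
  rewrite /position_sign [in RHS](cardsD1 y) inE yG /= exprD mulrA -expr2 sqrr_sign mul1r.
  by congr (_ ^+ _); apply: eq_card => u; rewrite !inE andbA.
have -> : (-1) ^+ #|[set y0 in x |: G | (y0 < y)%O]| =
    (-1) ^+ (x < y)%O * (-1) ^+ #|[set y0 in G | (y0 < y)%O]| :> rat.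
  rewrite -exprD [in LHS](cardsD1 x) !inE eqxx /=; congr (_ ^+ (_ + _)).
  by apply: eq_card => u; rewrite !inE; case: (u =P x) xG => [->|//]; case: (x \in G).
have /andP[GJ _] := fG; have := subsetP GJ y yG; rewrite inE => /andP[_ c].
by case/orP: c => c; rewrite c (lt_gtF c) expr1 expr0; ring.
Qed.

Lemma face_vec_cone x F : x \in F ->
  face_vec F = position_sign x (F :\ x) *: cone x (face_vec (F :\ x)).
Proof. by move=> xF; rewrite extendE scalerA position_signK scale1r setD1K. Qed.

(** A face of J either avoids x or is, up to sign, the cone of a face of the link
    of x. *)
Lemma kchains_split_mem (W : vectType rat) (U : {vspace W}) J x k
    (f : 'Hom(@chain_space d T, W)) :
  (forall z, z \in kchains (J :\ x) k -> f z \in U) ->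
  (forall i z, k = i.+1 -> z \in kchains (link J x) i -> f (cone x z) \in U) ->
  forall z, z \in kchains J k -> f z \in U.
Proof.
move=> f1 f2; apply: kchains_mem => F fF cF.
have [xF|xF] := boolP (x \in F).
  rewrite (face_vec_cone xF) linearZ memvZ //=.
  apply: (f2 #|F :\ x|); first by rewrite -cF (cardsD1 x) xF.
  by apply: face_kchains; apply: face_link.
apply: f1; rewrite -cF; apply: face_kchains.
by case/andP: fF => FJ cF'; rewrite /face cF' subsetD1 FJ xF.
Qed.

Lemma kchains_split_eq (W : vectType rat) J x k
    (f g : 'Hom(@chain_space d T, W)) :
  (forall z, z \in kchains (J :\ x) k -> f z = g z) ->
  (forall i z, k = i.+1 -> z \in kchains (link J x) i -> f (cone x z) = g (cone x z)) ->
  forall z, z \in kchains J k -> f z = g z.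
Proof.
move=> f1 f2 z zJ; apply/eqP; rewrite -subr_eq0 -memv0 -opp_lfunE -add_lfunE.
apply: (kchains_split_mem (x := x) _ _ zJ) => [u uJ|i u ki uJ].
  by rewrite !lfun_simpE /= f1 // subrr mem0v.
by rewrite !lfun_simpE /= (f2 i) // subrr mem0v.
Qed.

(** The linear map that is f on faces avoiding x and g on the base of the cone for
    the others ([split_map_away], [split_map_cone]). *)
Definition split_map x (f g : 'End(@chain_space d T)) : 'End(@chain_space d T) :=
  extend (fun F => if x \in F then position_sign x (F :\ x) *: g (face_vec (F :\ x))
                   else f (face_vec F)).

Lemma split_map_away J x f g k z : z \in kchains (J :\ x) k ->
  split_map x f g z = f z.
Proof.
apply: kchains_eq => F /andP[FJ _] _; rewrite extendE.
by move: FJ; rewrite subsetD1 => /andP[_ /negbTE ->].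
Qed.

Lemma split_map_cone J x f g k z : z \in kchains (link J x) k ->
  split_map x f g (cone x z) = g z.
Proof.
rewrite -[LHS]comp_lfunE; apply: kchains_eq => G fG _.
by rewrite !lfun_simpE extendE linearZ /= extendE setU11 setU1K ?(notin_link fG) //
  scalerA position_signK scale1r.
Qed.

(** The Mayer-Vietoris argument for the star of x and the complex of J :\ x, which
    meet in the link of x, on the level of homotopies.  With h1 and h2 contracting
    J :\ x and the link, the new homotopy is h1 on faces avoiding x and sends
    cone G to h1 (h2 G - h1 G) - cone (h2 G).  The correction term works because
    h2 G - h1 G has boundary h1 (boundary G) - h2 (boundary G). *)
Lemma acyclic_below_add J x n : x \in J ->
  acyclic_below n.+1 (J :\ x) -> acyclic_below n (link J x) ->
  acyclic_below n.+1 J.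
Proof.
move=> xJ [h1 c1] [h2 c2].
have lk k z : z \in kchains (link J x) k -> z \in kchains (J :\ x) k.
  by apply: subvP; apply: kchainsS; apply: link_sub.
have D1 k z : z \in kchains (J :\ x) k -> z \in kchains J k.
  by apply: subvP; apply: kchainsS; apply: subD1set.
pose g := (h1 \o (h2 - h1) - (cone x \o h2))%VF.
pose h := split_map x h1 g.
exists h => k z zJ; split.
  move: z zJ; apply: (@kchains_split_mem _ _ _ x) => [z zJ|i z -> zJ].
    by rewrite (split_map_away _ _ zJ) D1 //; case: (c1 _ _ zJ).
  have [h2z _] := c2 _ _ zJ; have [h1z _] := c1 _ _ (lk _ _ zJ).
  rewrite (split_map_cone _ _ zJ) /g !lfun_simpE memvB ?cone_kchains //.
  have [] := c1 i.+1 (h2 z - h1 z); last by move=> /D1.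
  by rewrite memvB // lk.
move=> kn; move: z zJ.
suff e z : z \in kchains J k -> ((boundary \o h) + (h \o boundary))%VF z = \1%VF z.
  by move=> z /e; rewrite !lfun_simpE.
move: z; apply: (@kchains_split_eq _ _ x) => [z zJ|i z ki zJ].
  rewrite !lfun_simpE (split_map_away _ _ zJ).
  rewrite (split_map_away _ _ (boundary_kchains_pred zJ)).
  by have [_ ->] := c1 _ _ zJ.
have {}kn : (i < n)%N by rewrite -ltnS -ki.
have dz := boundary_kchains_pred zJ.
rewrite !lfun_simpE (split_map_cone _ _ zJ) (boundary_cone zJ) linearB /=.
rewrite (split_map_cone _ _ dz) (split_map_away _ _ (lk _ _ zJ)) /g !lfun_simpE.
have [h2z /(_ kn) e2] := c2 _ _ zJ; have [h1z /(_ (ltnW kn)) e1] := c1 _ _ (lk _ _ zJ).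
have sJ : h2 z - h1 z \in kchains (J :\ x) i.+1 by rewrite memvB // lk.
have ds : boundary (h2 z - h1 z) = h1 (boundary z) - h2 (boundary z).
  rewrite linearB /= -{1}[boundary (h2 z)](addrK (h2 (boundary z))) e2.
  rewrite -[boundary (h1 z)](addrK (h1 (boundary z))) e1.
  by apply/ffunP => F; rewrite !ffunE; ring.
have [_ /(_ kn)] := c1 _ _ sJ; rewrite ds => e3.
have {}e3 : boundary (h1 (h2 z - h1 z)) =
    h2 z - h1 z - h1 (h1 (boundary z) - h2 (boundary z)) by rewrite -{2}e3 addrK.
have Xz : cone x z = cone x (boundary (h2 z)) + cone x (h2 (boundary z)).
  by rewrite -linearD /= e2.
rewrite [boundary (_ - _)]linearB /= e3 (boundary_cone h2z) Xz.
(* coordinatewise, this is an identity between rational numbers *)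
by rewrite !linearB /=; apply/ffunP => F; rewrite !ffunE; ring.
Qed.

(** Through the homotopy h2 of the link, r (cone G) = h2 G extends the identity of
    the complex of J :\ x to a retraction r that commutes with boundaries in the
    relevant degrees; then r composed with a homotopy for J is one for J :\ x. *)
Lemma acyclic_below_remove J x n : x \in J ->
  acyclic_below n J -> acyclic_below n (link J x) ->
  acyclic_below n (J :\ x).
Proof.
move=> xJ [h c] [h2 c2].
have lk k z : z \in kchains (link J x) k -> z \in kchains (J :\ x) k.
  by apply: subvP; apply: kchainsS; apply: link_sub.
have D1 k z : z \in kchains (J :\ x) k -> z \in kchains J k.
  by apply: subvP; apply: kchainsS; apply: subD1set.
pose r := split_map x \1%VF h2.
have rJ k z : z \in kchains J k -> r z \in kchains (J :\ x) k.
  move: z; apply: (@kchains_split_mem _ _ _ x) => [z zJ|i z -> zJ].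
    by rewrite (split_map_away _ _ zJ) !lfun_simpE.
  by rewrite (split_map_cone _ _ zJ) lk //; case: (c2 _ _ zJ).
have dr k z : (k <= n)%N -> z \in kchains J k -> boundary (r z) = r (boundary z).
  move=> kn zJ; rewrite -!comp_lfunE; move: z zJ.
  apply: (@kchains_split_eq _ _ x) => [z zJ|i z ki zJ]; rewrite !lfun_simpE.
    by rewrite (split_map_away _ _ zJ)
      (split_map_away _ _ (boundary_kchains_pred zJ)) !lfun_simpE.
  rewrite ki in kn; have [h2z /(_ kn) e2] := c2 _ _ zJ.
  rewrite (boundary_cone zJ) linearB /= (split_map_away _ _ (lk _ _ zJ)).
  rewrite !(split_map_cone _ _ zJ) (split_map_cone _ _ (boundary_kchains_pred zJ)).
  by rewrite !lfun_simpE -{2}e2 addrK.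
exists (r \o h)%VF => k z zJ; rewrite !lfun_simpE; have [hz e] := c _ _ (D1 _ _ zJ).
split=> [|kn]; first exact: rJ.
rewrite (dr _ _ _ hz) // -linearD /= e //.
by rewrite (split_map_away _ _ zJ) !lfun_simpE.
Qed.

End Removal.

(** * Cones and joins *)

Section Join.
Local Open Scope ring_scope.
Context {d : Order.disp_t} {T : finPOrderType d}.
Implicit Types (J A B F G : {set T}) (x y : T) (n k i j : nat) (z u v : @chain_space d T).

(** Inserting x is a contracting homotopy in all degrees. *)
Lemma acyclic_cone J x : x \in J -> {in J, forall y, (x >=< y)%O} -> acyclic J.
Proof.
move=> xJ cx n; have lk : link J x = J :\ x.
  apply/setP => y; rewrite !inE andbC; case: (boolP (y \in J)) => // yJ; rewrite ?andbF ?andbT //.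
  by case/comparable_ltgtP: (cx y yJ).
pose h := split_map x (cone x) 0.
exists h => k z zJ; split; [|move=> _]; move: z zJ.
  apply: (@kchains_split_mem _ _ _ _ _ x) => [z|i z -> zJ].
    move=> zJ; rewrite (split_map_away _ _ zJ).
    by apply: cone_kchains => //; rewrite lk.
  by rewrite (split_map_cone _ _ zJ) lfun_simpE mem0v.
suff e z : z \in kchains J k -> ((boundary \o h) + (h \o boundary))%VF z = \1%VF z.
  by move=> z /e; rewrite !lfun_simpE.
move: z; apply: (@kchains_split_eq _ _ _ _ x) => [z|i z ki zJ]; rewrite !lfun_simpE.
  move=> zJ; rewrite (split_map_away _ _ zJ).
  rewrite (split_map_away _ _ (boundary_kchains_pred zJ)).
  by rewrite -lk in zJ; rewrite (boundary_cone zJ) subrK.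
rewrite (split_map_cone _ _ zJ) (boundary_cone zJ) linearB /= lfun_simpE linear0 add0r.
rewrite (split_map_cone _ _ (boundary_kchains_pred zJ)) lfun_simpE subr0.
by rewrite (split_map_away _ _ (J := J) (k := i)) // -lk.
Qed.

(** The bilinear product that underlies the chain complex of a join. *)
Definition star u v : @chain_space d T :=
  \sum_F \sum_G ((u F : rat) * (v G : rat)) *: face_vec (F :|: G).

Lemma star_linearl a u u' v : star (a *: u + u') v = a *: star u v + star u' v.
Proof.
rewrite /star scaler_sumr -big_split; apply: eq_bigr => F _ /=.
rewrite scaler_sumr -big_split; apply: eq_bigr => G _ /=.
by rewrite scalerA -scalerDl !ffunE mulrDl mulrA.
Qed.

Lemma star_linearr a u v v' : star u (a *: v + v') = a *: star u v + star u v'.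
Proof.
rewrite /star scaler_sumr -big_split; apply: eq_bigr => F _ /=.
rewrite scaler_sumr -big_split; apply: eq_bigr => G _ /=.
by rewrite scalerA -scalerDl !ffunE mulrDr mulrCA.
Qed.

HB.instance Definition _ u :=
  GRing.isLinear.Build rat (@chain_space d T) (@chain_space d T) *:%R (star u)
    (fun a => star_linearr a u).

Lemma star0l v : star 0 v = 0.
Proof. by have := star_linearl (-1) 0 0 v; rewrite scaler0 addr0 scaleN1r addNr. Qed.

Lemma starZl a u v : star (a *: u) v = a *: star u v.
Proof. by rewrite -[a *: u]addr0 star_linearl star0l addr0. Qed.

Lemma starDl u u' v : star (u + u') v = star u v + star u' v.
Proof. by rewrite -[u in LHS]scale1r star_linearl scale1r. Qed.

Lemma star_face F G : star (face_vec F) (face_vec G) = face_vec (F :|: G).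
Proof.
rewrite /star (bigD1 F) //= [X in _ + X]big1 => [|F' nF]; last first.
  by apply: big1 => G' _; rewrite ffunE (negbTE nF) mul0r scale0r.
rewrite addr0 (bigD1 G) //= [X in _ + X]big1 => [|G' nG]; last first.
  by rewrite [face_vec G G']ffunE (negbTE nG) mulr0 scale0r.
by rewrite !ffunE !eqxx mulr1 scale1r addr0.
Qed.

(** The sign of the degree as an operator, so that the Leibniz rule
    [boundary_star] needs no explicit degree. *)
Definition parity : 'End(@chain_space d T) :=
  extend (fun F => (-1) ^+ #|F| *: face_vec F).

Lemma parityE J k z : z \in kchains J k -> parity z = (-1) ^+ k *: z.
Proof.
rewrite -[in RHS](id_lfunE z) -scale_lfunE; apply: kchains_eq => F _ <-.
by rewrite extendE scale_lfunE id_lfunE.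
Qed.

Variables (A B : {set T}).
Hypothesis ltAB : {in A & B, forall a b, (a < b)%O}.

Lemma join_notin x : x \in A -> x \notin B.
Proof. by move=> xA; apply/negP => /(ltAB xA); rewrite ltxx. Qed.

Lemma restrict_joinl F G : F \subset A -> G \subset B -> (F :|: G) :&: A = F.
Proof.
move=> FA GB; apply/setP => x; rewrite !inE; apply/andP/idP.
  by case=> /orP[//|/(subsetP GB) xB] /join_notin; rewrite xB.
by move=> xF; rewrite xF (subsetP FA).
Qed.

Lemma restrict_joinr F G : F \subset A -> G \subset B -> (F :|: G) :&: B = G.
Proof.
move=> FA GB; apply/setP => x; rewrite !inE; apply/andP/idP.
  by case=> /orP[/(subsetP FA) /join_notin xB|//]; rewrite (negbTE xB).
by move=> xF; rewrite xF orbT (subsetP GB).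
Qed.

Lemma join_disjoint F G : F \subset A -> G \subset B -> F :&: G = set0.
Proof.
move=> FA GB; apply/setP => x; rewrite !inE; apply/andP => -[/(subsetP FA)/join_notin xB].
by move/(subsetP GB); rewrite (negbTE xB).
Qed.

Lemma face_setU F G : face A F -> face B G -> face (A :|: B) (F :|: G).
Proof.
move=> /andP[FA cF] /andP[GB cG]; rewrite /face setUSS //=.
have FG x y : x \in F -> y \in G -> (x >=< y)%O.
  by move=> /(subsetP FA) xA /(subsetP GB) yB; rewrite lt_comparable // ltAB.
apply/chainP => x y /setUP[] xF /setUP[] yF.
- exact: (chainP _ cF).
- exact: FG.
- by rewrite comparable_sym FG.
- exact: (chainP _ cG).
Qed.

Lemma star_kchains i j u v : u \in kchains A i -> v \in kchains B j ->
  star u v \in kchains (A :|: B) (i + j).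
Proof.
move=> uA vB; move: u uA.
apply: kchains_ind => [|a F z fF cF zA]; first by rewrite star0l mem0v.
rewrite star_linearl memvD ?memvZ //; move: v vB {zA z}.
apply: kchains_ind => [|b G z fG cG zB]; first by rewrite linear0 mem0v.
rewrite star_linearr memvD ?memvZ // star_face -cF -cG.
have -> : (#|F| + #|G|)%N = #|F :|: G|.
  by rewrite cardsU (join_disjoint (proj1 (andP fF)) (proj1 (andP fG))) cards0 subn0.
exact/face_kchains/face_setU.
Qed.

(** All vertices of F precede those of G, so removing a vertex of G picks up #|F|
    additional sign changes. *)
Lemma boundary_star_face F G : face A F -> face B G ->
  boundary (face_vec (F :|: G)) =
  star (boundary (face_vec F)) (face_vec G) +
  (-1) ^+ #|F| *: star (face_vec F) (boundary (face_vec G)).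
Proof.
move=> /andP[FA _] /andP[GB _]; rewrite !boundary_face_vec /face_boundary.
have dis := join_disjoint FA GB.
rewrite (eq_bigl (fun x => (x \in F) || (x \in G))); last by move=> x; rewrite inE.
rewrite bigU /=; last by rewrite -setI_eq0 dis.
congr (_ + _).
  rewrite (big_morph (star ^~ _) (fun u u' => starDl u u' _) (star0l _)).
  apply: eq_bigr => x xF; rewrite starZl star_face.
  have -> : (F :|: G) :\ x = (F :\ x) :|: G.
    apply/setP => y; rewrite !inE; case: (y =P x) => //= ->.
    by apply/esym/negbTE/negP => xG; have := in_set0 x; rewrite -dis inE xF xG.
  congr (_ ^+ _ *: _); apply: eq_card => y; rewrite !inE.
  case: (boolP (y \in G)) => [/(subsetP GB) yB|_]; last by rewrite orbF.
  have xy := ltAB (subsetP FA _ xF) yB.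
  by rewrite (lt_gtF xy) !andbF.
rewrite [star _ (\sum_(_ in _) _)]linear_sum scaler_sumr; apply: eq_bigr => x xG.
rewrite /= [star _ (_ *: _)]linearZ /= star_face scalerA -exprD.
have -> : (F :|: G) :\ x = F :|: (G :\ x).
  apply/setP => y; rewrite !inE; case: (y =P x) => //= ->.
  by rewrite orbF; apply/esym/negbTE/negP => xF; have := in_set0 x; rewrite -dis inE xF xG.
congr (_ ^+ _ *: _).
have xB := subsetP GB _ xG.
have -> : [set y in F :|: G | (y < x)%O] = F :|: [set y in G | (y < x)%O].
  apply/setP => y; rewrite !inE; case: (boolP (y \in F)) => //= yF.
  by rewrite (ltAB (subsetP FA _ yF) xB).
rewrite cardsU (join_disjoint FA) ?cards0 ?subn0 //.
by apply/subsetP => y; rewrite inE => /andP[/(subsetP GB)].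
Qed.

Lemma boundary_star i j u v : u \in kchains A i -> v \in kchains B j ->
  boundary (star u v) = star (boundary u) v + star (parity u) (boundary v).
Proof.
move=> uA vB; move: u uA.
apply: kchains_ind => [|a F z fF cF zA].
  by rewrite !linear0 !star0l linear0 addr0.
rewrite !linearP /= !star_linearl linearP /= zA addrACA -scalerDr; congr (_ *: _ + _).
move: v vB {zA z}.
apply: kchains_ind => [|b G z fG cG zB]; first by rewrite !linear0 addr0.
rewrite !linearP /= zB addrACA -scalerDr; congr (_ *: _ + _).
rewrite star_face boundary_star_face //; congr (_ + _).
by rewrite [parity _]extendE starZl.
Qed.

(** The tensor product of homotopies.  Put e = 1 - d h - h d, a chain map that
    vanishes on faces with fewer than p (for A), respectively q (for B) vertices.
    The homotopy H = hA * 1 + parity eA * hB satisfies d H + H d = 1 - eA * eB, and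
    a face with fewer than p + q vertices has fewer than p in A or fewer than q in
    B. *)
Lemma acyclic_below_join p q : acyclic_below p A -> acyclic_below q B ->
  acyclic_below (p + q) (A :|: B).
Proof.
move=> [hA cA] [hB cB].
pose e (h : 'End(@chain_space d T)) := (\1 - (boundary \o h) - (h \o boundary))%VF.
pose g u v := star (hA u) v + star (parity (e hA u)) (hB v).
pose H : 'End(@chain_space d T) :=
  extend (fun F => g (face_vec (F :&: A)) (face_vec (F :&: B))).
have HE i j u v : u \in kchains A i -> v \in kchains B j -> H (star u v) = g u v.
  move=> uA vB; move: u uA.
  apply: kchains_ind => [|a F z fF cF zA].
    by rewrite /g !linear0 !star0l linear0 addr0.
  rewrite /g !linearP /= !star_linearl linearP /= zA addrACA -scalerDr; congr (_ *: _ + _).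
  move: v vB {zA z}.
  apply: kchains_ind => [|b G z fG cG zB]; first by rewrite !linear0 addr0.
  rewrite !linearP /= zB addrACA -scalerDr; congr (_ *: _ + _).
  case/andP: fF => FA _; case/andP: fG => GB _.
  by rewrite star_face extendE restrict_joinl // restrict_joinr.
have eA i u : u \in kchains A i -> e hA u \in kchains A i /\ ((i < p)%N -> e hA u = 0).
  move=> uA; have [h1 h2] := cA _ _ uA; rewrite /e !lfun_simpE; split; last first.
    by move=> /h2 h3; rewrite -addrA -opprD h3 subrr.
  rewrite memvB ?memvB //; first exact: (boundary_kchains h1).
  case: i uA {h1 h2} => [|i] uA; first by rewrite (boundary_kchains0 uA) linear0 mem0v.
  by case: (cA _ _ (boundary_kchains uA)).
have eB j v : v \in kchains B j -> (j < q)%N -> e hB v = 0.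
  move=> vB jq; have [_ h2] := cB _ _ vB; rewrite /e !lfun_simpE.
  by rewrite -addrA -opprD h2 // subrr.
have facedec k F : face (A :|: B) F -> #|F| = k ->
   [/\ face A (F :&: A), face B (F :&: B), (#|F :&: A| + #|F :&: B|)%N = k
     & F = (F :&: A) :|: (F :&: B)].
  move=> /andP[FAB cF] <-; rewrite /face !subsetIr !(chain_sub _ cF) ?subsetIl //.
  have e1 : F = (F :&: A) :|: (F :&: B) by rewrite -setIUr; apply/esym/setIidPl.
  split=> //; rewrite [in RHS]e1 cardsU (join_disjoint (subsetIr _ _) (subsetIr _ _)).
  by rewrite cards0 subn0.
exists H => k z zAB; split.
  move: z zAB; apply: kchains_mem => F fF cF.
  have [fA fB <- {1}->] := facedec _ _ fF cF.
  have vA := face_kchains fA; have vB := face_kchains fB.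
  rewrite -star_face (HE _ _ _ _ vA vB) /g.
  have [eu _] := eA _ _ vA.
  rewrite memvD //; first by rewrite -addSn star_kchains //; case: (cA _ _ vA).
  by rewrite -addnS star_kchains ?(parityE eu) ?memvZ //; case: (cB _ _ vB).
move=> kpq; move: z zAB.
suff E z : z \in kchains (A :|: B) k ->
    ((boundary \o H) + (H \o boundary))%VF z = \1%VF z.
  by move=> z /E; rewrite !lfun_simpE.
move: z; apply: kchains_eq => F fF cF; rewrite !lfun_simpE.
have [fA fB ck eF] := facedec _ _ fF cF; rewrite eF -star_face.
move: (face_kchains fA) (face_kchains fB) => uA vB.
rewrite -ck in kpq; move: (face_vec (F :&: A)) (face_vec (F :&: B)) uA vB.
move: #|F :&: A| #|F :&: B| kpq => i j ij u v uA vB {F fF cF fA fB ck eF k}.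
have [hu eu0] := cA _ _ uA; have [hv _] := cB _ _ vB.
have [eu eup] := eA _ _ uA.
have du := boundary_kchains_pred uA; have dv := boundary_kchains_pred vB.
have pu : parity u \in kchains A i by rewrite (parityE uA) memvZ.
have peu : parity (e hA u) \in kchains A i by rewrite (parityE eu) memvZ.
rewrite (HE _ _ _ _ uA vB) /g linearD /= (boundary_star hu vB) (boundary_star peu hv).
rewrite (boundary_star uA vB) linearD /= (HE _ _ _ _ du vB) (HE _ _ _ _ pu dv) /g.
pose s : rat := (-1) ^+ i; pose w := e hA u.
have ss : s * s = 1 by rewrite /s -signr_odd; case: odd; rewrite ?mulrNN mulr1.
(* from here on the degree i only enters through the sign s *)
have edu : e hA (boundary u) = boundary w.
  rewrite /w /e !lfun_simpE !linearB /= (boundaryK uA) (boundaryK hu) linear0.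
  by rewrite subr0 subr0.
have -> : parity (e hA (boundary u)) = - s *: boundary w.
  rewrite -edu /s; case: (i) uA du => [/boundary_kchains0 ->|m _ /= du].
    by rewrite [e hA 0]linear0 linear0 scaler0.
  have [edu' _] := eA _ _ du; by rewrite (parityE edu') exprS mulN1r opprK.
have -> : parity (hA u) = - s *: hA u by rewrite (parityE hu) exprS mulN1r.
have -> : parity (parity w) = w.
  by rewrite (parityE peu) (parityE eu) -/s scalerA ss scale1r.
have -> : parity w = s *: w by rewrite (parityE eu).
have -> : parity u = s *: u by rewrite (parityE uA).
have -> : parity (e hA (s *: u)) = w.
  by rewrite linearZ /= linearZ /= (parityE eu) -/s scalerA ss scale1r.
rewrite !linearZ /= !starZl !scaleNr.
have Ew : star w (boundary (hB v)) + star w (hB (boundary v)) = star w v.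
  rewrite -linearD /=; case: (ltnP i p) => [/eup w0|pi]; first by rewrite (w0 : w = 0) !star0l.
  have [_ ->] := cB _ _ vB => //.
  by rewrite -(ltn_add2l p); apply: leq_ltn_trans ij; rewrite leq_add2r.
have Eu : star u v = star w v + star (boundary (hA u)) v + star (hA (boundary u)) v.
  rewrite -!starDl; congr (star _ _); rewrite /w /e !lfun_simpE.
  by apply/ffunP => F; rewrite !ffunE; ring.
rewrite Eu -Ew; move: (s *: _) (s *: _) => X Y.
by apply/ffunP => F; rewrite !ffunE; ring.
Qed.

End Join.

(** * Isomorphisms and anti-isomorphisms *)

(** A map that preserves and reflects comparability on J induces an isomorphism of
    simplicial complexes.  It respects the orientations up to a sign eps that may
    only depend on the number of vertices. *)
Section Transfer.
Local Open Scope ring_scope.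
Context {d d' : Order.disp_t} {T : finPOrderType d} {T' : finPOrderType d'}.
Variables (J : {set T}) (f : T -> T') (eps : nat -> rat).
Hypothesis f_inj : {in J &, injective f}.
Hypothesis f_comp : {in J &, forall x y, (f x >=< f y)%O = (x >=< y)%O}.
Hypothesis epsK : forall k, eps k * eps k = 1.
Hypothesis f_sgn : forall F x, face J F -> x \in F ->
  eps #|F| * position_sign (f x) (f @: F) = eps #|F|.-1 * position_sign x F.

Let phi : 'Hom(@chain_space d T, @chain_space d' T') :=
  extend (fun F => eps #|F| *: face_vec (f @: F)).
Let psi : 'Hom(@chain_space d' T', @chain_space d T) :=
  extend (fun G : {set T'} => eps #|G| *: face_vec [set x in J | f x \in G]).

Let f_injF (F : {set T}) : F \subset J -> {in F &, injective f}.
Proof. by move=> /subsetP s x y /s xJ /s yJ; apply: f_inj. Qed.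

Let face_im F : face J F -> face (f @: J) (f @: F).
Proof.
move=> /andP[FJ cF]; rewrite /face imsetS //=.
apply/chainP => _ _ /imsetP[x xF ->] /imsetP[y yF ->].
by rewrite f_comp ?(subsetP FJ) // (chainP _ cF).
Qed.

Let face_preim (G : {set T'}) : face (f @: J) G ->
  face J [set x in J | f x \in G] /\ f @: [set x in J | f x \in G] = G.
Proof.
move=> /andP[GJ cG]; split.
  apply/andP; split; first by apply/subsetP => x; rewrite inE => /andP[].
  apply/chainP => x y; rewrite !inE => /andP[xJ xG] /andP[yJ yG].
  by rewrite -f_comp // (chainP _ cG).
apply/setP => y; apply/imsetP/idP => [[x]|yG]; first by rewrite inE => /andP[_ h] ->.
by have /imsetP[x xJ e] := subsetP GJ _ yG; exists x => //; rewrite inE xJ -e.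
Qed.

Let preim_im (F : {set T}) : F \subset J -> [set x in J | f x \in f @: F] = F.
Proof.
move=> FJ; apply/setP => x; rewrite inE; apply/andP/idP => [[xJ /imsetP[y yF]]|xF].
  by move/f_inj => -> //; apply: (subsetP FJ).
by rewrite (subsetP FJ) // imset_f.
Qed.

Let phi_kchains k z : z \in kchains J k -> phi z \in kchains (f @: J) k.
Proof.
apply: kchains_mem => F fF <-; rewrite extendE memvZ //.
rewrite -(card_in_imset (f_injF (proj1 (andP fF)))).
exact/face_kchains/face_im.
Qed.

Let psi_kchains k z : z \in kchains (f @: J) k -> psi z \in kchains J k.
Proof.
apply: kchains_mem => G fG <-; rewrite extendE memvZ //.
have [fP e] := face_preim fG.
rewrite -{2}e (card_in_imset (f_injF (proj1 (andP fP)))).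
exact: face_kchains.
Qed.

Let phiK k z : z \in kchains J k -> psi (phi z) = z.
Proof.
rewrite -comp_lfunE -[RHS]id_lfunE; apply: kchains_eq => F fF _.
have [FJ _] := andP fF; rewrite !lfun_simpE extendE linearZ /= extendE preim_im //.
by rewrite (card_in_imset (f_injF FJ)) scalerA epsK scale1r.
Qed.

Let psiK k z : z \in kchains (f @: J) k -> phi (psi z) = z.
Proof.
rewrite -comp_lfunE -[RHS]id_lfunE; apply: kchains_eq => G fG _.
have [fP e] := face_preim fG.
rewrite !lfun_simpE extendE linearZ /= extendE -(card_in_imset (f_injF (proj1 (andP fP)))).
by rewrite e scalerA epsK scale1r.
Qed.

Let boundary_phi k z : z \in kchains J k -> boundary (phi z) = phi (boundary z).
Proof.
rewrite -!comp_lfunE; apply: kchains_eq => F fF _; rewrite !lfun_simpE.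
have [FJ _] := andP fF; have finj := f_injF FJ.
rewrite [phi (face_vec F)]extendE linearZ /= !boundary_face_vec /face_boundary.
rewrite scaler_sumr [phi _]linear_sum /= (big_imset _ finj) /=; apply: eq_bigr => x xF.
rewrite [phi _]linearZ /= [phi _]extendE !scalerA.
have -> : (f @: F) :\ f x = f @: (F :\ x).
  apply/setP => y; rewrite !inE; apply/andP/imsetP => [[yx /imsetP[u uF e]]|[u]].
    by exists u => //; rewrite !inE uF andbT; apply: contraNneq yx => <-; rewrite e.
  rewrite !inE => /andP[ux uF] ->; split; last exact: imset_f.
  by apply: contra_neq ux => /finj ->.
have := f_sgn fF xF; rewrite /position_sign => ->; congr (_ *: _).
by rewrite mulrC; congr (_ * eps _); rewrite (cardsD1 x F) xF.
Qed.

Lemma acyclic_below_transfer n : acyclic_below n J -> acyclic_below n (f @: J).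
Proof.
move=> [h c]; exists (phi \o h \o psi)%VF => k z zJ; rewrite !lfun_simpE.
have pz := psi_kchains zJ; have [hz e] := c _ _ pz; split; first exact: phi_kchains.
move=> kn; have -> : psi (boundary z) = boundary (psi z).
  rewrite -{1}(psiK zJ) (boundary_phi pz).
  exact: (phiK (boundary_kchains_pred pz)).
by rewrite (boundary_phi hz) -linearD /= e // (psiK zJ).
Qed.

End Transfer.

Section Isomorphisms.
Local Open Scope ring_scope.
Context {d d' : Order.disp_t} {T : finPOrderType d} {T' : finPOrderType d'}.
Implicit Types (J : {set T}) (f : T -> T').

Lemma le_mono_comparable J f :
  {in J &, {mono f : x y / (x <= y)%O}} \/ {in J &, {mono f : x y /~ (x <= y)%O}} ->
  {in J &, forall x y, (f x >=< f y)%O = (x >=< y)%O} /\ {in J &, injective f}.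
Proof.
rewrite /Order.comparable; case=> fle; split=> x y xJ yJ.
- by rewrite !fle.
- by move=> e; apply: le_anti; rewrite -!fle // e lexx.
- by rewrite !fle // orbC.
- by move=> e; apply: le_anti; rewrite -!fle // e lexx.
Qed.

Lemma acyclic_below_iso J f n : {in J &, {mono f : x y / (x <= y)%O}} ->
  acyclic_below n J -> acyclic_below n (f @: J).
Proof.
move=> fle; have [fc fi] := le_mono_comparable (or_introl fle).
apply: (@acyclic_below_transfer _ _ _ _ J f (fun _ => 1)) => //.
move=> F x /andP[FJ _] xF; rewrite !mul1r /position_sign; congr (_ ^+ _).
rewrite -[RHS](card_in_imset (f := f)); last first.
  move=> u v; rewrite !inE => /andP[/(subsetP FJ) uJ _] /andP[/(subsetP FJ) vJ _].
  exact: fi.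
apply: eq_card => y; rewrite inE; apply/andP/imsetP => [[/imsetP[u uF ->] lt]|[u]].
  exists u => //; rewrite inE uF; move: lt.
  by rewrite !lt_leAnge !fle ?(subsetP FJ).
rewrite inE => /andP[uF lt] ->; rewrite imset_f //; move: lt.
by rewrite !lt_leAnge !fle ?(subsetP FJ).
Qed.

(** Reversing k vertices is a permutation with k (k - 1) / 2 inversions, whence the
    sign (-1) ^ 'C(k, 2). *)
Lemma acyclic_below_anti J f n : {in J &, {mono f : x y /~ (x <= y)%O}} ->
  acyclic_below n J -> acyclic_below n (f @: J).
Proof.
move=> fle; have [fc fi] := le_mono_comparable (or_intror fle).
apply: (@acyclic_below_transfer _ _ _ _ J f (fun k => (-1) ^+ 'C(k, 2))) => //.
  by move=> k; rewrite -signr_odd; case: odd; rewrite ?mulrNN mulr1.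
move=> F x /andP[FJ cF] xF; rewrite /position_sign.
have -> : #|[set y in f @: F | (y < f x)%O]| = #|[set y in F | (x < y)%O]|.
  rewrite -[RHS](card_in_imset (f := f)); last first.
    move=> u v; rewrite !inE => /andP[/(subsetP FJ) uJ _] /andP[/(subsetP FJ) vJ _].
    exact: fi.
  apply: eq_card => y; rewrite inE; apply/andP/imsetP => [[/imsetP[u uF ->] lt]|[u]].
    exists u => //; rewrite inE uF; move: lt.
    by rewrite !lt_leAnge !fle ?(subsetP FJ).
  rewrite inE => /andP[uF lt] ->; rewrite imset_f //; move: lt.
  by rewrite !lt_leAnge !fle ?(subsetP FJ).
have e : #|F| = (#|[set y in F | (x < y)%O]| + #|[set y in F | (y < x)%O]|).+1.
  rewrite (cardsD1 x) xF add1n -cardsUI [X in (_ + X)%N](_ : _ = 0%N) ?addn0.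
    congr _.+1; apply: eq_card => y; rewrite !inE andbC -andb_orr.
    case: (boolP (y \in F)) => // yF.
    by case/comparable_ltgtP: (chainP _ cF _ _ xF yF).
  apply/eqP; rewrite cards_eq0; apply/eqP/setP => y; rewrite !inE.
  by apply/negP => /andP[/andP[_ xy] /andP[_ /(lt_trans xy)]]; rewrite ltxx.
rewrite e binS bin1 /= !exprD -mulrA; congr (_ * _).
by rewrite mulrAC -expr2 sqrr_sign mul1r.
Qed.

End Isomorphisms.

(** * Deleting many vertices, barycentric subdivision *)

Section Deletion.
Local Open Scope order_scope.
Context {d : Order.disp_t} {T : finPOrderType d}.
Implicit Types (J A B F G S : {set T}) (x y : T) (n : nat).

Definition below J x := [set y in J | y < x].
Definition above J x := [set y in J | x < y].

Lemma linkE J x : link J x = below J x :|: above J x.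
Proof. by apply/setP => y; rewrite !inE andb_orr. Qed.

Lemma below_above J x : {in below J x & above J x, forall a b, a < b}.
Proof. by move=> a b; rewrite !inE => /andP[_ ax] /andP[_]; apply: lt_trans. Qed.

(** The link of x is the ordinal sum of what lies below and above x; a join with
    one acyclic factor is acyclic. *)
Lemma acyclic_link J x :
  acyclic (below J x) \/ acyclic (above J x) -> acyclic (link J x).
Proof.
rewrite linkE => -[] ac n; have BA := @below_above J x.
  by rewrite -[n]addn0; apply: acyclic_below_join => //; apply: acyclic_below0.
by rewrite -[n]add0n; apply: acyclic_below_join => //; apply: acyclic_below0.
Qed.

Lemma acyclic_below_delete J x n : x \in J -> acyclic (link J x) ->
  acyclic_below n (J :\ x) <-> acyclic_below n J.
Proof.
move=> xJ ac; split; last by move=> h; apply: acyclic_below_remove.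
by case: n => [|n] h; [apply: acyclic_below0 | apply: acyclic_below_add h (ac n)].
Qed.

(** The elements outside A are deleted from the largest to the smallest: when x is
    deleted, everything below x is still there, while above x only elements of A
    are left. *)
Lemma delete_descending A J : A \subset J ->
  {in J :\: A, forall x, acyclic (below J x) \/ acyclic (above A x)} ->
  forall n, acyclic_below n A <-> acyclic_below n J.
Proof.
move: {2}#|J :\: A| (leqnn #|J :\: A|) => m; elim: m J => [|m IHm] J.
  rewrite leqn0 cards_eq0 setD_eq0 => JA AJ _ n.
  by have -> : A = J by apply/eqP; rewrite eqEsubset AJ.
move=> card AJ ac n.
have [JA|[x0 x0J]] := set_0Vmem (J :\: A).
  by have -> : A = J by apply/eqP; rewrite eqEsubset AJ -setD_eq0 JA eqxx.
have [x xJA xmax] := exists_maximal x0J; have := xJA; rewrite inE => /andP[xA xJ].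
have aboveE : above J x = above A x.
  apply/setP => y; rewrite !inE; have [xy|] := boolP (x < y); rewrite ?andbF ?andbT //.
  apply/idP/idP => [yJ|]; last exact: subsetP.
  by apply/negPn/negP => yA; have := xmax y; rewrite xy !inE yA yJ => /(_ isT).
rewrite -(acyclic_below_delete n xJ); last first.
  by apply: acyclic_link; rewrite aboveE; apply: ac.
apply: IHm.
- have -> : (J :\ x) :\: A = (J :\: A) :\ x.
    by apply/setP => y; rewrite !inE andbCA.
  by move: card; rewrite (cardsD1 x) xJA.
- by rewrite subsetD1 AJ xA.
move=> y; rewrite !inE => /and3P[yA yx yJ]; have yJA : y \in J :\: A by rewrite inE yA.
have -> : below (J :\ x) y = below J y; last exact: ac.
apply/setP => z; rewrite !inE; case: (z =P x) => [->|] //=.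
by rewrite (negbTE (xmax y yJA)) andbF.
Qed.

(** Deleting from the smallest to the largest leaves everything above x in place. *)
Lemma delete_ascending A J : A \subset J ->
  {in J :\: A, forall x, acyclic (above J x) \/ acyclic (below A x)} ->
  forall n, acyclic_below n A <-> acyclic_below n J.
Proof.
move: {2}#|J :\: A| (leqnn #|J :\: A|) => m; elim: m J => [|m IHm] J.
  rewrite leqn0 cards_eq0 setD_eq0 => JA AJ _ n.
  by have -> : A = J by apply/eqP; rewrite eqEsubset AJ.
move=> card AJ ac n.
have [JA|[x0 x0J]] := set_0Vmem (J :\: A).
  by have -> : A = J by apply/eqP; rewrite eqEsubset AJ -setD_eq0 JA eqxx.
have [x xJA xmin] := exists_minimal x0J; have := xJA; rewrite inE => /andP[xA xJ].
have belowE : below J x = below A x.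
  apply/setP => y; rewrite !inE; have [xy|] := boolP (y < x); rewrite ?andbF ?andbT //.
  apply/idP/idP => [yJ|]; last exact: subsetP.
  by apply/negPn/negP => yA; have := xmin y; rewrite xy !inE yA yJ => /(_ isT).
rewrite -(acyclic_below_delete n xJ); last first.
  by apply: acyclic_link; rewrite belowE; apply/or_comm; apply: ac.
apply: IHm.
- have -> : (J :\ x) :\: A = (J :\: A) :\ x.
    by apply/setP => y; rewrite !inE andbCA.
  by move: card; rewrite (cardsD1 x) xJA.
- by rewrite subsetD1 AJ xA.
move=> y; rewrite !inE => /and3P[yA yx yJ]; have yJA : y \in J :\: A by rewrite inE yA.
have -> : above (J :\ x) y = above J y; last exact: ac.
apply/setP => z; rewrite !inE; case: (z =P x) => [->|] //=.
by rewrite (negbTE (xmin y yJA)) andbF.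
Qed.

(** If J is acyclic without its minimal element x, then J is a suspension of the
    link of x up to homology, which shifts the bound by one. *)
Lemma acyclic_below_delete_min J x n :
  x \in J -> {in J, forall y, ~~ (y < x)} -> acyclic (J :\ x) ->
  acyclic_below n (above J x) -> acyclic_below n.+1 J.
Proof.
move=> xJ xmin acJ acx; apply: (acyclic_below_add xJ (acJ _)).
suff -> : link J x = above J x by [].
apply/setP => y; rewrite !inE; have [yJ|//] := boolP (y \in J).
by rewrite (negbTE (xmin y yJ)).
Qed.

Lemma acyclic_min J x : x \in J -> {in J, forall y, x <= y} -> acyclic J.
Proof. by move=> xJ h; apply: (acyclic_cone xJ) => y /h; apply: le_comparable. Qed.

Lemma acyclic_max J x : x \in J -> {in J, forall y, y <= x} -> acyclic J.
Proof.
move=> xJ h; apply: (acyclic_cone xJ) => y /h yx.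
by rewrite comparable_sym le_comparable.
Qed.

End Deletion.

Section Subdivision.
Local Open Scope order_scope.
Import Order.DefaultSetSubsetOrder.
Context {d : Order.disp_t} {T : finPOrderType d}.
Implicit Types (D F G : {set T}) (x : T) (n : nat).

Lemma le_set F G : (F <= G) = (F \subset G).
Proof. by []. Qed.

Definition subdivision D : {set {set T}} := [set F | (F != set0) && face D F].

(** The principal ideals inside D form a copy of D in the poset of subsets. *)
Definition ideal D x : {set T} := [set y in D | y <= x].

(** Let Z consist of the nonempty chains and of the principal ideals of D, ordered
    by inclusion.  It collapses to both parts.  Among the ideals strictly
    containing a chain F that is no ideal, the ideal of the largest element of F is
    the smallest one.  The nonempty chains contained in the ideal of x form a cone:
    F is below F + x, which is above the chain {x}. *)
Lemma acyclic_below_subdivision D n : acyclic_below n D -> acyclic_below n (subdivision D).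
Proof.
move=> acD; pose Z : {set {set T}} := subdivision D :|: (ideal D @: D).
have ideal_sub x : ideal D x \subset D by apply/subsetP => y; rewrite inE => /andP[].
have idE x F : x \in D -> F \subset D -> (F <= ideal D x) = [forall y in F, y <= x].
  move=> xD FD; apply/subsetP/forall_inP => h y yF; first by have := h y yF; rewrite inE => /andP[].
  by rewrite inE (subsetP FD) // h.
(* first from the ideals up to Z, then from Z down to the chains *)
have acI : acyclic_below n (ideal D @: D).
  apply: acyclic_below_iso acD => x y xD yD; rewrite idE //.
  apply/forall_inP/idP => [|xy z]; first by apply; rewrite inE xD lexx.
  by rewrite inE => /andP[_ zx]; apply: le_trans zx xy.
have acZ : acyclic_below n Z.
  apply: (proj1 (delete_descending (A := ideal D @: D) _ _ n)) acI.
    exact: subsetUr.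
  move=> F; rewrite !inE => /andP[FI /orP[|FI']]; last by rewrite FI' in FI.
  move=> /andP[/set0Pn[x0 x0F] /andP[FD cF]]; right.
  have [m mF mmax] := chain_max cF x0F; have mD := subsetP FD _ mF.
  apply: (@acyclic_min _ _ _ (ideal D m)).
    rewrite inE imset_f //= lt_neqAle idE //; apply/andP; split.
      by apply: contraNneq FI => ->; apply: imset_f.
    by apply/forall_inP.
  move=> _ /[!inE] /andP[/imsetP[x xD ->] /ltW]; rewrite !idE // => /forall_inP h.
  by apply/forall_inP => y; rewrite inE => /andP[_ ym]; apply: le_trans ym (h _ mF).
apply: (proj2 (delete_ascending (A := subdivision D) _ _ n)) acZ; first exact: subsetUl.
move=> F; rewrite !inE => /andP[FnD /orP[FD|/imsetP[x xD eF]]]; first by rewrite FD in FnD.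
have xF : x \in F by rewrite eF inE xD lexx.
have Fn0 : F != set0 by apply/set0Pn; exists x.
rewrite Fn0 /= in FnD; right; set B := below _ _.
have BP G : (G \in B) = [&& G != set0, G \subset F & chain G].
  rewrite !inE /face; apply/andP/and3P => [[/and3P[-> GD ->] /ltW]|[-> GF cG]] //.
  have GD : G \subset D by apply: subset_trans GF _; rewrite eF.
  rewrite GD cG lt_neqAle; split=> //; apply/andP; split; last by [].
  by apply: contraNneq FnD => <-; rewrite /face GD.
clearbody B; have xB : [set x] \in B.
  rewrite BP sub1set xF -card_gt0 cards1 /=.
  by apply/chainP => u v /set1P -> /set1P ->; apply: comparablexx.
have le_x y : y \in F -> y <= x by rewrite eF inE => /andP[].
move=> m; apply: (proj1 (delete_descending (A := [set G in B | x \in G]) _ _ m)).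
- by apply/subsetP => G; rewrite inE => /andP[].
- move=> G; rewrite in_setD inE => /andP[nx GB]; right; rewrite GB /= in nx.
  move: GB; rewrite BP => /and3P[Gn0 GF cG].
  apply: (@acyclic_min _ _ _ (x |: G)).
    rewrite inE; apply/andP; split; last first.
      rewrite lt_neqAle le_set subsetUr andbT; apply: contraNneq nx => ->.
      exact: setU11.
    rewrite inE setU11 andbT BP subUset sub1set xF GF /=; apply/andP; split.
      by apply/set0Pn; exists x; rewrite setU11.
    apply: chain_setU1 => // y yG.
    by rewrite comparable_sym le_comparable // le_x // (subsetP GF).
  move=> H; rewrite inE inE => /andP[/andP[_ xH] /ltW GH].
  by rewrite le_set subUset sub1set xH.
apply: (@acyclic_min _ _ _ [set x]).
  by rewrite inE xB set11.
by move=> H; rewrite inE => /andP[_ xH]; rewrite le_set sub1set.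
Qed.

End Subdivision.

(** * Rank functions; criteria for Cohen-Macaulay and Eulerian posets *)

Section RankFunctions.
Local Open Scope order_scope.
Context {d : Order.disp_t} {T : finPOrderType d}.
Implicit Types (s t u w x y : T) (C F A : {set T}) (r : T -> nat).

(** The conclusion is asked for coverings; compatibility with the order then
    follows from finiteness ([rank_function_lt]). *)
Definition rank_function r := forall s t, s < t ->
  (forall w, ~~ (s < w < t)) -> r t = (r s).+1.

Definition open_interval s t : {set T} := [set w | s < w < t].

(** Subsets of chains are chains, so maximality only has to be tested against
    single additional elements. *)
Lemma maximal_chainP A C : reflect
  [/\ C \subset A, chain C &
      forall x, x \in A -> {in C, forall y, x >=< y} -> x \in C]
  (maximal_chain A C).
Proof.
apply: (iffP maxsetP) => [[/andP[CA cC] Cmax]|[CA cC Cmax]].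
  split=> // x xA cx; rewrite -(Cmax (x |: C)) ?setU11 ?subsetUr //.
  by rewrite subUset sub1set xA CA chain_setU1.
split=> [|C' /andP[CA' cC'] CC']; first by rewrite CA.
apply/eqP; rewrite eqEsubset CC' andbT; apply/subsetP => x xC'.
apply: Cmax => [|y yC]; first exact: (subsetP CA').
by apply: (chainP _ cC') => //; apply: (subsetP CC').
Qed.

Lemma exists_maximal_chain A : exists C, maximal_chain A C.
Proof.
have [|C Cmax _] := @maxset_exists _ (fun c => (c \subset A) && chain c) set0.
  by rewrite sub0set; apply/chainP => x y; rewrite inE.
by exists C.
Qed.

Section Fixed.
Variable r : T -> nat.
Hypothesis rP : rank_function r.

Lemma rank_function_lt s t : s < t -> (r s < r t)%N.
Proof.
move: {2}#|_| (leqnn #|open_interval s t|) => m; elim: m s t => [|m IHm] s t.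
  rewrite leqn0 cards_eq0 => /eqP e st; rewrite (rP st) // => w.
  by apply/negP => sw; have := in_set0 w; rewrite -e inE sw.
move=> cm st; have [/pred0P e|/pred0Pn[w /= /andP[sw wt]]] :=
    boolP (pred0b (fun w => s < w < t)).
  by rewrite (rP st) // => w; rewrite e.
have sub u v : s <= u -> v <= t -> w \notin open_interval u v ->
    (#|open_interval u v| <= m)%N.
  move=> su vt nw; rewrite -ltnS; apply: leq_trans cm; apply: proper_card.
  apply/properP; split; last by exists w; rewrite // inE sw.
  apply/subsetP => x; rewrite !inE => /andP[ux xv].
  by rewrite (le_lt_trans su ux) (lt_le_trans xv vt).
apply: (@ltn_trans (r w)); apply: IHm => //; apply: sub;
  by rewrite ?inE ?ltxx ?andbF // ltW.
Qed.

Lemma rank_function_le s t : s <= t -> (r s <= r t)%N.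
Proof. by rewrite le_eqVlt => /orP[/eqP ->//|/rank_function_lt/ltnW]. Qed.

(** By induction: without its top t, a maximal chain of [s, t] is a maximal chain
    of [s, u] for an element u covered by t. *)
Lemma maximal_chain_card s t C : s <= t ->
  maximal_chain (closed_interval s t) C -> #|C| = (r t - r s).+1.
Proof.
move: {2}#|C| (leqnn #|C|) => m; elim: m s t C => [|m IHm] s t C Cm st.
  move: Cm; rewrite leqn0 cards_eq0 => /eqP -> /maximal_chainP[_ _ /(_ s)].
  rewrite !inE lexx st => sC.
  have : false by apply: (sC isT) => y; rewrite inE.
  by [].
move=> /maximal_chainP[CI cC Cmax].
have CI' x : x \in C -> s <= x <= t by move/(subsetP CI); rewrite inE.
have sC : s \in C.
  apply: Cmax => [|y /CI' /andP[sy _]]; first by rewrite inE lexx st.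
  exact: le_comparable.
have tC : t \in C.
  apply: Cmax => [|y /CI' /andP[_ yt]]; first by rewrite inE lexx st.
  by rewrite comparable_sym le_comparable.
have [e|nst] := eqVneq s t.
  have -> : C = [set s].
    apply/eqP; rewrite eqEsubset sub1set sC andbT; apply/subsetP => x /CI'.
    by rewrite -e inE eq_sym -eq_le.
  by rewrite cards1 e subnn.
have sC' : s \in C :\ t by rewrite !inE nst.
have [u uC' umax] := chain_max (chain_sub (subD1set C t) cC) sC'.
have := uC'; rewrite !inE => /andP[nut uC].
have /andP[su ut'] := CI' u uC; have ut : u < t by rewrite lt_neqAle nut.
have cov w : ~~ (u < w < t).
  apply/negP => /andP[uw wt]; have wC : w \in C.
    apply: Cmax => [|y yC]; first by rewrite inE (le_trans su (ltW uw)) ltW.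
    have [->|yt] := eqVneq y t; first exact: lt_comparable.
    rewrite comparable_sym le_comparable // (le_trans _ (ltW uw)) //.
    by apply: umax; rewrite !inE yt.
  by have := umax w; rewrite !inE wC (lt_eqF wt) => /(_ isT); rewrite lt_geF.
rewrite (cardsD1 t) tC add1n (IHm s u) //.
- by rewrite (rP ut cov) subSn // rank_function_le.
- by rewrite -ltnS; move: Cm; rewrite (cardsD1 t) tC.
apply/maximal_chainP; split.
- apply/subsetP => x xC'; rewrite inE umax // andbT.
  by have := xC'; rewrite inE => /andP[_ /CI' /andP[]].
- exact: chain_sub (subD1set C t) cC.
move=> x; rewrite inE => /andP[sx xu] cx.
rewrite !inE (lt_eqF (le_lt_trans xu ut)); apply: Cmax => [|y yC].
  by rewrite inE sx (le_trans xu) // ltW.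
have [->|yt] := eqVneq y t; first by rewrite le_comparable // (le_trans xu) // ltW.
by apply: cx; rewrite !inE yt.
Qed.

Lemma graded_rank_function : graded T.
Proof.
move=> s t C C' st mC mC'; rewrite /chain_length.
by rewrite (maximal_chain_card st mC) (maximal_chain_card st mC').
Qed.

Lemma chain_card_interval s t F : F \subset open_interval s t -> chain F ->
  (#|F| <= (r t - r s).-1)%N.
Proof.
move=> FI cF; rewrite cardE -(size_map r) -subn1 -subnDA addn1.
rewrite -(size_iota (r s).+1 (r t - (r s).+1)); apply: uniq_leq_size.
  rewrite map_inj_in_uniq ?enum_uniq // => x y; rewrite !mem_enum => xF yF e.
  have := chainP _ cF _ _ xF yF.
  by case/comparable_ltgtP=> // /rank_function_lt; rewrite e ltnn.
move=> k /mapP[x]; rewrite mem_enum => /(subsetP FI) /[!inE] /andP[sx xt] ->.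
by rewrite mem_iota; have := rank_function_lt sx; have := rank_function_lt xt; lia.
Qed.

Lemma exists_chain_interval s t : s < t ->
  exists2 F, face (open_interval s t) F & #|F| = (r t - r s).-1.
Proof.
move=> st; have [C mC] := exists_maximal_chain (closed_interval s t).
have [CI cC Cmax] := maximal_chainP _ _ mC.
have CI' x : x \in C -> s <= x <= t by move/(subsetP CI); rewrite inE.
have sC : s \in C.
  apply: Cmax => [|y /CI' /andP[sy _]]; first by rewrite inE lexx ltW.
  exact: le_comparable.
have tC : t \in C.
  apply: Cmax => [|y /CI' /andP[_ yt]]; first by rewrite inE lexx ltW.
  by rewrite comparable_sym le_comparable.
exists (C :\ t :\ s).
  rewrite /face (chain_sub _ cC) ?andbT.
    apply/subsetP => x; rewrite !inE => /and3P[xs xt /CI' /andP[sx x't]].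
    by rewrite !lt_neqAle sx x't xt eq_sym xs.
  by apply: subset_trans (subD1set _ _) (subD1set _ _).
have := maximal_chain_card (ltW st) mC.
rewrite (cardsD1 t) tC (cardsD1 s (C :\ t)) !inE (lt_eqF st) sC /=.
by rewrite !add1n => -[<-].
Qed.

End Fixed.

End RankFunctions.

Section GradedRank.
Local Open Scope order_scope.
Context {d : Order.disp_t} {P : finBPOrderType d}.
Implicit Types (s t : P) (C : {set P}).

Lemma rank_maximal_chain s C : graded P ->
  maximal_chain (closed_interval \bot s) C -> rank s = chain_length C.
Proof.
move=> gP mC; apply/eqP; rewrite eqn_leq; apply/andP; split.
  by apply/bigmax_leqP => C' mC'; rewrite (gP _ _ _ _ (le0x s) mC mC').
exact: leq_bigmax_cond.
Qed.

Lemma rankE (r : P -> nat) s : rank_function r -> rank s = (r s - r \bot)%N.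
Proof.
move=> rP; have [C mC] := exists_maximal_chain (closed_interval \bot s).
rewrite (rank_maximal_chain (graded_rank_function rP) mC) /chain_length.
by rewrite (maximal_chain_card rP (le0x s) mC).
Qed.

(** If t covers s, adding t to a maximal chain of [\bot, s] yields a maximal chain
    of [\bot, t]. *)
Lemma graded_rankP : graded P -> rank_function (rank : P -> nat).
Proof.
move=> gP s t st cov; have [C mC] := exists_maximal_chain (closed_interval \bot s).
have [CI cC Cmax] := maximal_chainP _ _ mC.
have CI' x : x \in C -> x <= s by move/(subsetP CI); rewrite inE => /andP[].
have sC : s \in C.
  apply: Cmax => [|y /CI' ys]; first by rewrite inE lexx le0x.
  by rewrite comparable_sym le_comparable.
have tC : t \notin C by apply/negP => /CI'; rewrite lt_geF.
have mtC : maximal_chain (closed_interval \bot t) (t |: C).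
  apply/maximal_chainP; split.
  - apply/subsetP => x /setU1P[->|/CI' xs]; rewrite inE le0x ?lexx //.
    exact: le_trans xs (ltW st).
  - apply: chain_setU1 => // y /CI' ys.
    by rewrite comparable_sym le_comparable // (le_trans ys) // ltW.
  move=> x; rewrite inE => /andP[_ xt] cx; apply/setU1P.
  have [->|nxt] := eqVneq x t; [by left|right].
  apply: Cmax => [|y yC]; last by apply: cx; rewrite inE yC orbT.
  rewrite inE le0x /=; have := cx s; rewrite inE sC orbT => /(_ isT).
  case/comparable_ltgtP=> // sx.
  by have := cov x; rewrite sx lt_neqAle nxt xt.
rewrite (rank_maximal_chain gP mC) (rank_maximal_chain gP mtC) /chain_length.
by rewrite cardsU1 tC add1n /= prednK // card_gt0; apply/set0Pn; exists s.
Qed.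

Lemma rank_bot : rank (\bot : P) = 0%N.
Proof.
apply/eqP; rewrite -leqn0; apply/bigmax_leqP => C /maximal_chainP[CI _ _].
rewrite /chain_length leqn0 -subn1 subn_eq0 -(cards1 (\bot : P)) subset_leq_card //.
by apply: subset_trans CI _; apply/subsetP => x; rewrite !inE lex0 => /andP[_].
Qed.

End GradedRank.

Section CohenMacaulayCriterion.
Local Open Scope order_scope.
Context {d : Order.disp_t}.

Lemma CohenMacaulay_interval (P : finPOrderType d) (r : P -> nat) (s t : P) :
  rank_function r -> CohenMacaulay P -> s < t ->
  acyclic_below (r t - r s).-1 (open_interval s t).
Proof.
move=> rP cmP st; apply: vanishing_acyclic_below => k kn; apply: cmP.
  by exists s, t; split=> //; constructor 1.
have [F fF cF] := exists_chain_interval rP st.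
rewrite /complex_dim ltrD2r ltz_nat; apply: leq_trans kn _; rewrite -cF.
by apply: leq_bigmax_cond; rewrite inE.
Qed.

(** In a bounded poset the order ideals and filters that count as open intervals
    are cones over an extremal element, so only the intervals (s, t) matter. *)
Lemma CohenMacaulay_criterion (P : finTBPOrderType d) (r : P -> nat) :
  rank_function r ->
  (forall s t : P, s < t -> acyclic_below (r t - r s).-1 (open_interval s t)) ->
  CohenMacaulay P.
Proof.
move=> rP acP J [s [t [st [] ->]]] i idim.
- apply: (acyclic_below_vanishing (acP s t st)).
  apply: lt_le_trans idim _; rewrite /complex_dim lerD2r lez_nat.
  by apply/bigmax_leqP => F; rewrite inE => /andP[FI cF]; apply: chain_card_interval FI cF.
- have ac : acyclic [set w | w < t].
    apply: (@acyclic_min _ _ _ \bot) => [|y _]; last exact: le0x.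
    by rewrite inE; apply: le_lt_trans st.
  apply: (acyclic_below_vanishing (ac `|(i + 2)%R|%N)); lia.
- have ac : acyclic [set w | s < w].
    apply: (@acyclic_max _ _ _ \top) => [|y _]; last exact: lex1.
    by rewrite inE; apply: lt_le_trans st _.
  apply: (acyclic_below_vanishing (ac `|(i + 2)%R|%N)); lia.
Qed.

End CohenMacaulayCriterion.

Section EulerianCriterion.
Local Open Scope ring_scope.
Context {d : Order.disp_t} {P : finTBPOrderType d}.

Lemma sign_sub (a b : nat) : (b <= a)%N ->
  (-1) ^+ (a - b) = (-1) ^+ b * (-1) ^+ a :> int.
Proof.
by move=> ba; rewrite -{2}(subnKC ba) exprD mulrA -expr2 sqrr_sign mul1r.
Qed.

Lemma sum_interval_top (F : P -> int) s t : (s < t)%O ->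
  \sum_(u : P | (s <= u <= t)%O) F u = \sum_(u : P | (s <= u < t)%O) F u + F t.
Proof.
move=> st; rewrite (bigD1 t) /=; last by rewrite lexx ltW.
rewrite addrC; congr (_ + _); apply: eq_bigl => u.
by rewrite [(u < t)%O]lt_neqAle -andbA [(u != t) && _]andbC.
Qed.

(** The Moebius function mu(s, _) is characterised by mu(s, s) = 1 and by the
    vanishing of its sums over [s, t] for s < t.  The function
    (-1)^(rank u - rank s) only differs from (-1)^(rank u) by a constant sign. *)
Lemma Eulerian_criterion : graded P ->
  Eulerian P <-> (forall s t : P, (s < t)%O ->
    \sum_(u : P | (s <= u <= t)%O) (-1) ^+ rank u = 0 :> int).
Proof.
move=> gP; have rP := graded_rankP gP.
split=> [[_ muP] s t st|eP].
  have mu0 : \sum_(u : P | (s <= u <= t)%O) mobius s u = 0.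
    by rewrite sum_interval_top // [mobius s t]mobius_neq ?subrr // (lt_eqF st).
  apply: (can_inj (mulKr (unitrX (rank s) (unitrN1 _)))).
  rewrite mulr0 -[RHS]mu0 mulr_sumr; apply: eq_bigr => u /andP[su _].
  by rewrite muP // sign_sub // rank_function_le.
split=> // s t; move: {2}(rank t) (leqnn (rank t)) => m.
elim: m t => [|m IHm] t tm st.
  suff -> : s = t by rewrite mobius_xx subnn.
  apply/eqP; apply: contraTT tm => nst.
  by rewrite -ltnNge (leq_ltn_trans _ (rank_function_lt rP (_ : s < t)%O)) // lt_neqAle nst.
have [->|nst] := eqVneq s t; first by rewrite mobius_xx subnn.
have st' : (s < t)%O by rewrite lt_neqAle nst.
rewrite mobius_neq // (eq_bigr (fun u => (-1) ^+ rank s * (-1) ^+ rank u)).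
  have := eP s t st'; rewrite sum_interval_top // => /eqP; rewrite addr_eq0 => /eqP e.
  by rewrite -mulr_sumr e mulrN opprK sign_sub // rank_function_le.
move=> u /andP[su ut]; rewrite IHm //; first by rewrite sign_sub // rank_function_le.
by rewrite -ltnS; apply: leq_trans (rank_function_lt rP ut) tm.
Qed.

End EulerianCriterion.

(** * The elements and the rank of the stellahedral transform *)

Section StellElements.
Local Open Scope order_scope.
Context {d : Order.disp_t} {P : finTBPOrderType d}.
Implicit Types (c : {set P}) (x y : P) (u v w : Stell P).

(** The element (c, y); for a pair that is not admissible the value is the added
    maximum, so lemmas about [stell_elt] assume [stell_pair]. *)
Definition stell_elt c y : Stell P := insub (c, y).

Definition stell_top : Stell P := None.

Variant stell_spec : Stell P -> Type :=
| StellTop : stell_spec stell_top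
| StellElt c y of stell_pair (c, y) : stell_spec (stell_elt c y).

Lemma stellP u : stell_spec u.
Proof.
case: u => [[[c y] cy]|]; last exact: StellTop.
have -> : Some (exist _ (c, y) cy) = stell_elt c y by rewrite /stell_elt (insubT _ cy).
exact: StellElt.
Qed.

Lemma stell_pairP c y : reflect
  [/\ chain c, \bot \in c & {in c, forall x, x <= y}] (stell_pair (c, y)).
Proof.
apply: (iffP and3P) => /= -[cc c0 cy]; split=> //; first exact/forall_inP.
exact/forall_inP.
Qed.

Lemma stell_elt_le c y c' y' : stell_pair (c, y) -> stell_pair (c', y') ->
  (stell_elt c y <= stell_elt c' y') = (c \subset c') && (y' <= y).
Proof. by move=> cy cy'; rewrite /stell_elt !insubT. Qed.

Lemma stell_elt_lt_top c y : stell_pair (c, y) -> stell_elt c y < stell_top.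
Proof. by move=> cy; rewrite lt_leAnge /stell_elt !insubT. Qed.

Lemma stell_elt_inj c y c' y' : stell_pair (c, y) -> stell_pair (c', y') ->
  stell_elt c y = stell_elt c' y' -> c = c' /\ y = y'.
Proof. by move=> cy cy'; rewrite /stell_elt !insubT => -[-> ->]. Qed.

Lemma stell_elt_lt c y c' y' : stell_pair (c, y) -> stell_pair (c', y') ->
  (stell_elt c y < stell_elt c' y') =
  [&& c \subset c', y' <= y & (c != c') || (y != y')].
Proof.
move=> cy cy'; rewrite lt_neqAle stell_elt_le // andbC -andbA; congr [&& _, _ & _].
rewrite -negb_and; congr (~~ _); apply/eqP/andP => [|[/eqP -> /eqP -> //]].
by case/(stell_elt_inj cy cy') => -> ->.
Qed.

Lemma stell_pair_sub c c' y y' : stell_pair (c', y') -> c \subset c' ->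
  \bot \in c -> y' <= y -> stell_pair (c, y).
Proof.
move=> /stell_pairP[cc' c0' cy'] cc c0 yy; apply/stell_pairP; split=> //.
  exact: chain_sub cc'.
by move=> x /(subsetP cc)/cy' h; apply: le_trans h yy.
Qed.

Lemma stell_pair_add c x y : stell_pair (c, y) -> x <= y ->
  {in c, forall z, x >=< z} -> stell_pair (x |: c, y).
Proof.
move=> /stell_pairP[cc c0 cy] xy cx; apply/stell_pairP; split.
- exact: chain_setU1.
- by rewrite inE c0 orbT.
by move=> z /setU1P[->|/cy].
Qed.

Lemma stell_pair_comparable c y : stell_pair (c, y) -> {in c, forall z, y >=< z}.
Proof. by move=> /stell_pairP[_ _ cy] z /cy; rewrite comparable_sym => /le_comparable. Qed.

Definition stell_rank u : nat :=
  if u is Some v then #|(val v).1|.-1 + (rank (\top : P) - rank (val v).2)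
  else (rank (\top : P)).+1.

Lemma stell_rank_elt c y : stell_pair (c, y) ->
  stell_rank (stell_elt c y) = (#|c|.-1 + (rank (\top : P) - rank y))%N.
Proof. by move=> cy; rewrite /stell_elt insubT. Qed.

Lemma card_stell_pair c y : stell_pair (c, y) -> (0 < #|c|)%N.
Proof. by case/stell_pairP=> _ c0 _; rewrite card_gt0; apply/set0Pn; exists \bot. Qed.

Hypothesis gradedP : graded P.
Let rankP := graded_rankP gradedP.

(** If (c, y) < (c', y') differ in both components, then (c', y) lies in between;
    if they differ by several elements of c', a single one of them can be added
    first.  If the maximum covers (c, y), then no element of [\bot, y] can be added
    to c, so c is a maximal chain there and #|c| = rank y + 1. *)
Lemma stell_rank_function : rank_function stell_rank.
Proof.
move=> s t; case: (stellP s) => [|c y cy]; first by move=> /lt_geF; rewrite stell_le_top.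
have [cc c0 cley] := stell_pairP _ _ cy; have cgt0 := card_stell_pair cy.
have yn := rank_function_le rankP (lex1 y).
case: (stellP t) => [_ cov|c' y' cy' lt cov]; rewrite !stell_rank_elt //=.
  have Cmax x : x <= y -> {in c, forall z, x >=< z} -> x \in c.
    move=> xy cx; have xcy := stell_pair_add cy xy cx.
    have := cov (stell_elt (x |: c) y).
    rewrite stell_elt_lt_top // andbT stell_elt_lt // subsetUr lexx eqxx orbF negbK.
    by move/eqP => ->; rewrite setU11.
  have mc : maximal_chain (closed_interval \bot y) c.
    apply/maximal_chainP; split=> //.
      by apply/subsetP => x xc; rewrite inE le0x cley.
    by move=> x; rewrite inE => /andP[_ xy]; apply: Cmax.
  have := maximal_chain_card rankP (le0x y) mc.
  by rewrite rank_bot subn0 => -> /=; rewrite subnKC.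
have := lt; rewrite stell_elt_lt // => /and3P[sc yy' ne].
have [e|nc] := eqVneq c c'.
  move: ne; rewrite e eqxx /= => ne.
  have yy : y' < y by rewrite lt_neqAle eq_sym ne.
  suff : rank y = (rank y').+1 by move: yn; lia.
  apply: rankP => // w; apply/negP => /andP[y'w wy].
  have cw : stell_pair (c', w) by apply: stell_pair_sub cy' _ _ (ltW y'w); rewrite -?e.
  have := cov (stell_elt c' w); rewrite e in cy *.
  by rewrite !stell_elt_lt // !subxx !ltW //= !eqxx (gt_eqF wy) (gt_eqF y'w).
have c'y : stell_pair (c', y).
  by apply: stell_pair_sub cy' _ _ yy' => //; apply: (subsetP sc).
have e : y = y'.
  have := cov (stell_elt c' y).
  by rewrite !stell_elt_lt // !subxx sc yy' lexx nc !eqxx /= negbK => /eqP.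
subst y'.
have [x xc' xc] : exists2 x, x \in c' & x \notin c.
  by apply/subsetPn; apply: contraNN nc => c'c; rewrite eqEsubset sc.
have sx : x |: c \subset c' by rewrite subUset sub1set xc'.
have xcy : stell_pair (x |: c, y).
  by apply: stell_pair_sub c'y sx _ _; rewrite ?inE ?c0 ?orbT.
have -> : c' = x |: c.
  have := cov (stell_elt (x |: c) y).
  rewrite !stell_elt_lt // sx subsetUr lexx eqxx !orbF /= negb_and !negbK.
  by case/orP => /eqP // e; rewrite e setU11 in xc.
by rewrite cardsU1 xc add1n -addSn prednK.
Qed.

Lemma stell_rank_bot : stell_rank \bot = 0%N.
Proof.
have cy : stell_pair ([set \bot], \top : P) by exact: stell_bot_subproof.
have -> : \bot = stell_elt [set \bot] \top by rewrite /stell_elt insubT //=; congr Some; apply: val_inj.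
by rewrite stell_rank_elt // cards1 subnn.
Qed.

Lemma rank_stell u : rank u = stell_rank u.
Proof. by rewrite (rankE _ stell_rank_function) stell_rank_bot subn0. Qed.

Lemma graded_stell : graded (Stell P).
Proof. exact: graded_rank_function stell_rank_function. Qed.

End StellElements.

(** * The Eulerian property *)

Section SignSums.
Local Open Scope ring_scope.

(** Toggling an element of B that is not in A reverses the sign. *)
Lemma sum_sign_interval (T : finType) (A B : {set T}) : A \proper B ->
  \sum_(C : {set T} | (A \subset C) && (C \subset B)) (-1) ^+ #|C| = 0 :> int.
Proof.
move=> /properP[AB [x xB xA]].
pose tog (C : {set T}) := if x \in C then C :\ x else x |: C.
have togK : involutive tog.
  move=> C; rewrite /tog; have [xC|xC] := boolP (x \in C).
    by rewrite !inE eqxx /= setD1K.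
  by rewrite setU11 setU1K.
set S := \sum_(_ | _) _; have : S = - S.
  rewrite {1}/S (reindex_inj (inv_inj togK)) -sumrN /=.
  apply: eq_big => [C|C _].
    rewrite /tog; case: ifP => xC.
      rewrite subsetD1 xA andbT; congr (_ && _).
      by rewrite -[in RHS](setD1K xC) subUset sub1set xB.
    rewrite subUset sub1set xB /=; congr (_ && _); apply/idP/idP => [|AC].
      move=> /subsetP s; apply/subsetP => y yA; have := s y yA.
      by rewrite !inE => /orP[/eqP e|//]; rewrite -e yA in xA.
    by apply: subset_trans AC (subsetUr _ _).
  rewrite /tog; case: ifP => xC.
    by rewrite [in RHS](cardsD1 x) xC exprS mulN1r opprK.
  by rewrite cardsU1 xC exprS mulN1r.
lia.
Qed.

End SignSums.

Section StellSums.
Local Open Scope ring_scope.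
Context {d : Order.disp_t} {P : finTBPOrderType d}.
Implicit Types (c : {set P}) (x y : P).

Lemma sum_stell (Q : pred (Stell P)) (F : Stell P -> int) :
  \sum_(u : Stell P | Q u) F u =
  (if Q (stell_top : Stell P) then F stell_top else 0) +
  \sum_c \sum_(y | stell_pair (c, y) && Q (stell_elt c y)) F (stell_elt c y).
Proof.
rewrite pair_big_dep /= (bigID (pred1 (stell_top : Stell P))) /=; congr (_ + _).
  case: ifP => Qt; last by rewrite big_pred0 // => u; case: eqP => [->|]; rewrite ?Qt ?andbF.
  by rewrite (big_pred1 stell_top) // => u; rewrite /= andbC; case: eqP => // ->.
pose h (p : {set P} * P) : Stell P := stell_elt p.1 p.2.
pose h' (u : Stell P) := if u is Some v then val v else (set0, \bot%O).
rewrite (reindex_onto h h') /=; last first.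
  move=> u /andP[_]; case: (stellP u) => [|c y cy]; first by rewrite eqxx.
  by move=> _; rewrite (_ : h' (stell_elt c y) = (c, y)) // /h' /stell_elt insubT.
apply: eq_bigl => -[c y] /=; rewrite /h /=.
have [cy|ncy] := boolP (stell_pair (c, y)).
  by rewrite /h' /stell_elt insubT /= andbT eqxx andbT.
by rewrite /stell_elt insubN //= andbF.
Qed.

Hypothesis eulerP : forall s t : P, (s < t)%O ->
    \sum_(u : P | (s <= u <= t)%O) (-1) ^+ rank u = 0 :> int.
Hypothesis gradedP : graded P.
Let rankP := graded_rankP gradedP.

(** Induction on the top element y.  Removing y from a chain leaves a chain that
    contains c :\ y and has its own top u, which ranges over the elements with
    b <= u < y where b is the largest element of c :\ y.  The induction hypothesis
    and the Eulerian condition on [b, y] give the value. *)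
Lemma sum_chains_top c y : stell_pair (c, y) ->
  \sum_(c' | [&& chain c', c \subset c' & is_top y c']) (-1) ^+ #|c'| =
    - (-1) ^+ rank y :> int.
Proof.
move: {2}(rank y) (leqnn (rank y)) => m; elim: m y c => [|m IHm] y c ym cy;
  have [cc c0 cley] := stell_pairP _ _ cy.
  have y0 : y = \bot%O.
    apply/eqP; rewrite -lex0; apply: contraLR ym; rewrite -ltnNge => y0.
    apply: leq_ltn_trans (leq0n (rank (\bot%O : P))) _; apply: (rank_function_lt rankP).
    by rewrite lt_neqAle le0x andbT eq_sym -lex0.
  rewrite y0 rank_bot expr0 (big_pred1 [set \bot%O]) ?cards1 // => c' /=.
  apply/and3P/eqP => [[_ _ /is_topP[bc' ble]]|->].
    apply/eqP; rewrite eqEsubset sub1set bc' andbT; apply/subsetP => x /ble.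
    by rewrite lex0 inE.
  split; first by apply/chainP => u v /set1P -> /set1P ->; apply: comparablexx.
    by apply/subsetP => x /cley; rewrite y0 lex0 inE.
  by apply/is_topP; split; [rewrite inE | move=> x /set1P ->].
have [y0|y_gt0] := eqVneq y \bot%O; first by apply: IHm => //; rewrite y0 rank_bot.
have bcy : \bot%O \in c :\ y by rewrite !inE eq_sym y_gt0.
have [b [bt bE]] := chain_top (chain_sub (subD1set c y) cc) bcy.
have [] := is_topP _ _ bt; rewrite !inE => /andP[nby bc] bmax.
have by' : (b < y)%O by rewrite lt_neqAle nby cley.
pose R b' u := [&& chain b', c :\ y \subset b' & is_top u b'].
transitivity (- \sum_(u | (b <= u < y)%O) \sum_(b' | R b' u) (-1) ^+ #|b'| : int).
  rewrite (exchange_big_dep (fun b' => [&& chain b', c :\ y \subset b' &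
     [forall x in b', (x < y)%O]])) /=; last first.
    move=> u b' /andP[_ uy] /and3P[-> -> /is_topP[_ ule]] /=.
    by apply/forall_inP => x /ule xu; apply: le_lt_trans xu uy.
  rewrite -sumrN (reindex_onto (fun b' => y |: b') (fun b' => b' :\ y)) /=; last first.
    by move=> c' /and3P[_ _ /andP[yc' _]]; rewrite setD1K.
  apply: eq_big => [b'|b'].
    apply/idP/idP.
      move=> /andP[/and3P[cb cyb /is_topP[_ yb]] /eqP e].
      have yb' : y \notin b' by rewrite -e !inE eqxx.
      apply/and3P; split; first exact: chain_sub (subsetUr _ _) cb.
        by rewrite subDset.
      apply/forall_inP => x xb; rewrite lt_neqAle yb ?inE ?xb ?orbT // andbT.
      by apply: contraNneq yb' => <-.
    move=> /and3P[cb cyb /forall_inP lb].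
    have yb' : y \notin b' by apply/negP => /lb; rewrite ltxx.
    rewrite setU1K // eqxx andbT; apply/and3P; split.
    - by apply: chain_setU1 => // z /lb/lt_comparable; rewrite comparable_sym.
    - by rewrite -subDset.
    - by apply/is_topP; split=> [|x /setU1P[->|/lb/ltW]]; rewrite ?setU11.
  move=> /andP[/and3P[cb cyb cyt] /eqP e].
  (* the inner sum has one term: u must be the top of b' *)
  have yb' : y \notin b' by rewrite -e !inE eqxx.
  have sb : c :\ y \subset b' by rewrite subDset.
  have [u [ut uE]] := chain_top (chain_sub (subsetUr [set y] b') cb) (subsetP sb _ bcy).
  have [ub' umax] := is_topP _ _ ut.
  rewrite (big_pred1 u) ?cardsU1 ?yb' ?exprS ?mulN1r // => v /=.
  rewrite /R uE (chain_sub (subsetUr [set y] b') cb) sb /=.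
  case: eqP => [->|]; rewrite ?andbF ?andbT // umax ?(subsetP sb) ?inE ?nby //=.
  rewrite lt_neqAle; apply/andP; split; first by apply: contraNneq yb' => <-.
  by have /is_topP[_] := cyt; apply; rewrite inE ub' orbT.
have := eulerP by'; rewrite sum_interval_top // => /eqP; rewrite addr_eq0 => /eqP <-.
rewrite -sumrN; apply: eq_bigr => u /andP[bu uy].
rewrite IHm ?opprK //; first by rewrite -ltnS; apply: leq_trans (rank_function_lt rankP uy) ym.
apply/stell_pairP; split=> //; first exact: chain_sub (subD1set c y) cc.
by move=> x /bmax xb; apply: le_trans xb bu.
Qed.

(** The sum factors over the Boolean lattice [c, c'] and the interval [y', y]; one
    of the two is not a single point. *)
Lemma sum_stell_pair c y c' y' : stell_pair (c, y) -> stell_pair (c', y') ->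
  (stell_elt c y < stell_elt c' y')%O ->
  \sum_(u | (stell_elt c y <= u <= stell_elt c' y')%O) (-1) ^+ stell_rank u = 0 :> int.
Proof.
move=> cy cy'; rewrite stell_elt_lt // => /and3P[sc yy' ne].
have [_ c0 _] := stell_pairP _ _ cy.
rewrite sum_stell /= ifF; last first.
  by rewrite (lt_geF (stell_elt_lt_top cy')) andbF.
rewrite add0r.
transitivity (\sum_(b : {set P} | (c \subset b) && (b \subset c'))
   \sum_(z | (y' <= z <= y)%O) ((-1) ^+ rank (\top%O : P) * - (-1) ^+ #|b|) * (-1) ^+ rank z : int).
  rewrite [RHS]big_mkcond; apply: eq_bigr => b _ /=.
  have [/andP[cb bc']|nb] := boolP (_ && _); last first.
    rewrite big_pred0 // => z; apply/negbTE/negP => /andP[bz].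
    by rewrite !stell_elt_le // => /andP[/andP[h1 _] /andP[h2 _]]; rewrite h1 h2 in nb.
  apply: eq_big => [z|z /andP[bz _]].
    apply/andP/andP => [[bz]|[y'z zy]].
      by rewrite !stell_elt_le // => /andP[/andP[_ h1] /andP[_ h2]].
    have bz : stell_pair (b, z).
      by apply: stell_pair_sub cy' bc' _ y'z; apply: (subsetP cb).
    by rewrite !stell_elt_le // cb bc' y'z zy.
  rewrite stell_rank_elt // exprD sign_sub ?(rank_function_le rankP) ?lex1 //.
  have := card_stell_pair bz; case: #|b| => // k _; rewrite exprS /=; lia.
under eq_bigr => b _ do rewrite -mulr_sumr.
have [e|nc] := eqVneq c c'.
  apply: big1 => b _; rewrite eulerP ?mulr0 //.
  by move: ne; rewrite e eqxx /= lt_neqAle yy' eq_sym => ->.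
by rewrite -mulr_suml -mulr_sumr sumrN sum_sign_interval ?oppr0 ?mulr0 ?mul0r // properEneq nc.
Qed.

(** For a chain b with largest element m, the second components run over [m, y].
    The sum over them vanishes unless m = y, which leaves the chains counted by
    [sum_chains_top]. *)
Lemma sum_stell_top c y : stell_pair (c, y) ->
  \sum_(u | (stell_elt c y <= u <= stell_top)%O) (-1) ^+ stell_rank u = 0 :> int.
Proof.
move=> cy; have [cc c0 cley] := stell_pairP _ _ cy.
rewrite sum_stell /= ifT; last by rewrite (ltW (stell_elt_lt_top cy)) lexx.
pose n := rank (\top%O : P).
rewrite (eq_bigr (fun b => if [&& chain b, c \subset b & is_top y b] then
     (-1) ^+ n * (- (-1) ^+ rank y) * (-1) ^+ #|b| else 0 : int)).
  rewrite -big_mkcond -mulr_sumr sum_chains_top // mulrN mulrN mulNr opprK exprS -/n.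
  by rewrite -mulrA -expr2 sqrr_sign mulr1 mulN1r addNr.
move=> b _.
have [/and3P[cb sb tb]|nb] := ifPn.
  have [yb leb] := is_topP _ _ tb.
  have by' : stell_pair (b, y) by apply/stell_pairP; split=> //; apply: (subsetP sb).
  rewrite (big_pred1 y) => [|z /=]; last first.
    apply/andP/eqP => [[bz]|->]; last by rewrite stell_elt_le // sb lexx stell_le_top.
    rewrite stell_elt_le // => /andP[/andP[_ zy] _].
    by apply: le_anti; rewrite zy; have [_ _ ->] := stell_pairP _ _ bz.
  rewrite stell_rank_elt // exprD sign_sub ?(rank_function_le rankP) ?lex1 // -/n.
  have := card_stell_pair by'; case: #|b| => // k _; rewrite exprS /=; lia.
have [/andP[cb sb]|nb'] := boolP (chain b && (c \subset b)); last first.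
  rewrite big_pred0 // => z; apply/negbTE/negP => /andP[bz].
  rewrite stell_elt_le // => /andP[/andP[sb _] _].
  by rewrite sb andbT in nb'; have [cb _ _] := stell_pairP _ _ bz; rewrite cb in nb'.
have [m [mt mE]] := chain_top cb (subsetP sb _ c0); have [mb lem] := is_topP _ _ mt.
rewrite cb sb mE /= in nb.
rewrite (eq_bigl (fun z => m <= z <= y)%O); last first.
  move=> z; apply/andP/andP => [[bz]|[mz zy]].
    rewrite stell_elt_le // => /andP[/andP[_ zy] _]; split=> //.
    by have [_ _ ->] := stell_pairP _ _ bz.
  have bz : stell_pair (b, z).
    apply/stell_pairP; split=> //; first exact: (subsetP sb).
    by move=> x /lem xm; apply: le_trans xm mz.
  by rewrite stell_elt_le // sb zy stell_le_top.
have [my|nmy] := boolP (m < y)%O; last first.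
  rewrite big_pred0 // => z; apply/negbTE/negP => /andP[mz zy].
  by move: nmy; rewrite lt_neqAle eq_sym nb (le_trans mz zy).
rewrite (eq_bigr (fun z => (-1) ^+ #|b|.-1 * (-1) ^+ n * (-1) ^+ rank z)).
  by rewrite -mulr_sumr eulerP ?mulr0.
move=> z /andP[mz zy]; have bz : stell_pair (b, z).
  apply/stell_pairP; split=> //; first exact: (subsetP sb).
  by move=> x /lem xm; apply: le_trans xm mz.
by rewrite stell_rank_elt // exprD sign_sub ?(rank_function_le rankP) ?lex1 // -/n mulrA mulrAC.
Qed.

End StellSums.

Lemma Eulerian_stell (d : Order.disp_t) (P : finTBPOrderType d) :
  graded P -> Eulerian P -> Eulerian (Stell P).
Proof.
move=> gP /(Eulerian_criterion gP) eP; apply/Eulerian_criterion.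
  exact: graded_stell.
move=> s t st; under eq_bigr => u _ do rewrite rank_stell //.
move: st; case: (stellP s) => [/lt_geF|c y cy]; first by rewrite stell_le_top.
case: (stellP t) => [_|c' y' cy' lt]; first exact: sum_stell_top.
exact: sum_stell_pair.
Qed.

(** * Intervals below the added maximum *)

Section StellAcyclic.
Local Open Scope order_scope.
Context {d : Order.disp_t} {P : finTBPOrderType d}.
Hypothesis gradedP : graded P.
Hypothesis cmP : CohenMacaulay P.
Implicit Types (c f : {set P}) (x y : P) (u v w : Stell P).
Let rankP := graded_rankP gradedP.
Local Notation elt := stell_elt.

(** Induction on the number of elements of c' not in c.  If there are none, the
    interval is dual to an open interval of P.  Otherwise pick one, x, and let p be
    the element (x |: c, y), an atom of the interval.  Without p the interval
    collapses to the elements whose chain avoids x, which have a largest element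
    q = (c' :\ x, y'): from a pair u whose chain contains x, dropping x gives the largest
    such element below u. *)
Lemma acyclic_pair c y c' y' : stell_pair (c, y) -> stell_pair (c', y') ->
  c \subset c' -> y' <= y ->
  acyclic_below (#|c' :\: c| + (rank y - rank y')).-1
    (open_interval (elt c y) (elt c' y')).
Proof.
move: {2}#|c' :\: c| (erefl #|c' :\: c|) => m; elim: m c y => [|m IHm] c y.
  move=> /eqP; rewrite cards_eq0 setD_eq0 => sc' cy cy' sc yy'.
  have e : c = c' by apply/eqP; rewrite eqEsubset sc.
  rewrite -{c' sc sc'}e in cy' *; rewrite setDv cards0 add0n.
  have [e|ne] := eqVneq y' y; first by rewrite e subnn; apply: acyclic_below0.
  have lt : y' < y by rewrite lt_neqAle ne.
  have cP z : y' <= z -> stell_pair (c, z).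
    by move=> y'z; apply: stell_pair_sub cy' _ _ y'z => //; case/stell_pairP: cy.
  have -> : open_interval (elt c y) (elt c y') = elt c @: open_interval y' y.
    apply/setP => u; rewrite inE; apply/idP/imsetP => [|[z /[!inE] /andP[y'z zy] ->]].
      case: (stellP u) => [/andP[_ /lt_geF]|b z bz]; first by rewrite stell_le_top.
      rewrite !stell_elt_lt // => /andP[/and3P[cb zy h1] /and3P[bc y'z h2]].
      have e : b = c by apply/eqP; rewrite eqEsubset bc.
      exists z; last by rewrite e.
      by move: h1 h2; rewrite e eqxx /= inE !lt_neqAle zy y'z ![_ == z]eq_sym => -> ->.
    have cz := cP z (ltW y'z).
    by rewrite !stell_elt_lt // subxx !ltW // (gt_eqF zy) (gt_eqF y'z) !orbT.
  apply: acyclic_below_anti; last exact: CohenMacaulay_interval.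
  move=> u v; rewrite !inE => /andP[/ltW yu _] /andP[/ltW yv _].
  by rewrite stell_elt_le ?subxx // cP.
move=> cm cy cy' sc yy'; have [cc' c0' cley'] := stell_pairP _ _ cy'.
have [_ c0 _] := stell_pairP _ _ cy.
have [x] : exists x, x \in c' :\: c by apply/set0Pn; rewrite -card_gt0 cm.
rewrite inE => /andP[xc xc'].
have sx : x |: c \subset c' by rewrite subUset sub1set xc'.
have cxm : #|c' :\: (x |: c)| = m.
  apply/eqP; rewrite -eqSS -cm (cardsD1 x (c' :\: c)) !inE xc xc' add1n eqSS.
  by rewrite setUC -setDDl.
have [/andP[/eqP ec /eqP ey]|ne] := boolP ((x |: c == c') && (y == y')).
  rewrite cm ey subnn addn0 /=; suff -> : m = 0%N by exact: acyclic_below0.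
  by rewrite -cxm ec setDv cards0.
have cxy : stell_pair (x |: c, y) by apply: stell_pair_sub cy' sx _ yy'; rewrite inE c0 orbT.
set J := open_interval _ _; set p := elt (x |: c) y.
have bx : \bot \in c' :\ x by rewrite !inE c0' andbT; apply: contraNneq xc => <-.
have qP : stell_pair (c' :\ x, y') by apply: stell_pair_sub cy' (subD1set _ _) bx _.
have cNx : c != x |: c by apply: contraNneq xc => ->; rewrite setU11.
have pJ : p \in J.
  rewrite inE !stell_elt_lt // subsetUr lexx sx yy' cNx /=.
  by move: ne; rewrite negb_and.
have N1 : (0 < m + (rank y - rank y'))%N.
  rewrite lt0n addn_eq0 negb_and; move: ne; rewrite negb_and => /orP[nc|ny].
    apply/orP; left; rewrite -cxm cards_eq0 setD_eq0.
    by apply: contraNN nc => h; rewrite eqEsubset sx.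
  apply/orP; right; rewrite subn_eq0 -ltnNge; apply: (rank_function_lt rankP).
  by rewrite lt_neqAle eq_sym ny.
have acp : acyclic_below (m + (rank y - rank y')).-1 (above J p).
  have -> : above J p = open_interval p (elt c' y').
    apply/setP => u; rewrite !inE andbC; have [pu|//] := boolP (p < u).
    move: pJ; rewrite inE => /andP[sp _].
    by rewrite (lt_trans sp pu).
  by rewrite -cxm; apply: IHm.
rewrite cm addSn -[X in acyclic_below X](prednK N1).
apply: (acyclic_below_delete_min pJ _ _ acp).
  move=> u; rewrite inE; case: (stellP u) => [/andP[_ /lt_geF]|b z bz]; first by rewrite stell_le_top.
  rewrite !stell_elt_lt // => /andP[/and3P[cb zy h1] _].
  apply/negP => /and3P[bxc yz h2]; have e : z = y by apply: le_anti; rewrite zy.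
  rewrite e eqxx /= ?orbF in h1 h2.
  have xb : x \notin b.
    apply: contraNN h2 => xb; rewrite eqEsubset bxc subUset sub1set xb cb.
    by [].
  move: h1; rewrite eqEsubset cb /= => /negP; apply; apply/subsetP => t tb.
  have := subsetP bxc t tb; rewrite !inE => /orP[/eqP et|//].
  by rewrite -et tb in xb.
set q := elt (c' :\ x) y'.
have leq b z : stell_pair (b, z) -> elt b z <= elt c' y' -> (elt b z <= q) = (x \notin b).
  by move=> bz; rewrite !stell_elt_le // => /andP[bc ->]; rewrite subsetD1 bc andbT.
move=> n; apply: (proj1 (delete_ascending (A := [set u in J | u <= q]) _ _ n)).
- apply/subsetP => u; rewrite !inE => /andP[-> uq]; rewrite andbT.
  apply: contraTneq uq => ->; rewrite leq ?setU11 //.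
  by move: pJ; rewrite inE => /andP[_ /ltW].
- move=> u; rewrite !inE => /andP[nq /andP[up /andP[su ut]]]; right.
  rewrite su ut /= in nq; move: nq su ut up.
  case: (stellP u) => [_ _ /lt_geF|b z bz]; first by rewrite stell_le_top.
  move=> nq su ut up; rewrite leq ?ltW // negbK in nq.
  have [cb zy _] := and3P (etrans (esym (stell_elt_lt cy bz)) su).
  have [bc' y'z _] := and3P (etrans (esym (stell_elt_lt bz cy')) ut).
  have vP : stell_pair (b :\ x, z).
    apply: stell_pair_sub bz (subD1set _ _) _ _ => //.
    by rewrite !inE (subsetP cb) // andbT; apply: contraNneq xc => <-.
  have vu : elt (b :\ x) z < elt b z.
    rewrite stell_elt_lt // subD1set lexx /=; apply/orP; left.
    by apply: contraTneq nq => <-; rewrite !inE eqxx.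
  apply: (@acyclic_max _ _ _ (elt (b :\ x) z)).
    rewrite !inE vu andbT (lt_trans vu ut) andbT leq ?(ltW (lt_trans vu ut)) //.
    rewrite !inE eqxx andbT stell_elt_lt // subsetD1 cb xc zy /=.
    move: up; apply: contraNT; rewrite negb_or !negbK => /andP[/eqP ec /eqP <-].
    by rewrite /p ec setD1K.
  move=> w; rewrite !inE => /andP[/andP[/andP[_ wt] wq] /ltW].
  move: wt wq; case: (stellP w) => [/lt_geF|b1 z1 bz1]; first by rewrite stell_le_top.
  by move=> wt; rewrite (leq _ _ bz1 (ltW wt)) !stell_elt_le // subsetD1 => -> /andP[-> ->].
apply: (@acyclic_max _ _ _ q); last by move=> u; rewrite inE => /andP[_].
rewrite !inE lexx andbT !stell_elt_lt // subsetD1 sc xc yy' subD1set lexx /=.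
rewrite eqxx orbF; apply/andP; split; last first.
  by apply/eqP => e; move: xc'; rewrite -e !inE eqxx.
by move: ne; apply: contraNT; rewrite negb_or !negbK => /andP[/eqP -> /eqP ->]; rewrite setD1K ?eqxx.
Qed.

End StellAcyclic.

(** * Intervals ending at the added maximum *)

Section StellUpper.
Local Open Scope order_scope.
Import Order.DefaultSetSubsetOrder.
Context {d : Order.disp_t} {P : finTBPOrderType d}.
Hypothesis gradedP : graded P.
Hypothesis cmP : CohenMacaulay P.
Implicit Types (b c f : {set P}) (x y z : P) (u v w : Stell P).
Let rankP := graded_rankP gradedP.
Local Notation elt := stell_elt.

(** The elements that refine the chain c below its top y: the union of the open
    intervals between consecutive elements of c. *)
Definition gaps c y : {set P} :=
  [set x | [&& x < y, x \notin c & [forall z in c, x >=< z]]].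

(** The gap below the top y is the last summand of an ordinal sum whose other
    summands are the gaps of c :\ y.  The bounds add up, since each element of c
    other than \bot costs one. *)
Lemma acyclic_gaps c y : chain c -> \bot \in c -> is_top y c ->
  acyclic_below ((rank y).+1 - #|c|) (gaps c y).
Proof.
move: {2}#|c| (erefl #|c|) => m; elim: m c y => [|m IHm] c y cm cc c0 /is_topP[yc ymax].
  by move/eqP: cm; rewrite cards_eq0 => /eqP e; rewrite e inE in c0.
have cD : #|c :\ y| = m by move: cm; rewrite (cardsD1 y) yc => -[].
have [y0|y0] := eqVneq y \bot.
  rewrite y0 rank_bot; have -> : (1 - #|c| = 0)%N by rewrite cm; lia.
  exact: acyclic_below0.
have bc : \bot \in c :\ y by rewrite !inE eq_sym y0.
have cc' := chain_sub (subD1set c y) cc.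
have [t [tt _]] := chain_top cc' bc; have [] := is_topP _ _ tt.
rewrite !inE => /andP[nty tc] tmax.
have ty : t < y by rewrite lt_neqAle nty ymax.
have -> : gaps c y = gaps (c :\ y) t :|: open_interval t y.
  apply/setP => x; rewrite !inE; apply/and3P/orP => [[xy xc /forall_inP cx]|].
    have := cx t tc; case/comparable_ltgtP=> [xt|tx|e]; last by rewrite e tc in xc.
      left; rewrite (negbTE xc) andbF /=; apply/forall_inP => z.
      by rewrite inE => /andP[_ /cx].
    by right; rewrite xy.
  case=> [/and3P[xt xc /forall_inP cx]|/andP[tx xy]].
    have xy := lt_trans xt ty; rewrite lt_eqF //= in xc.
    split=> //; apply/forall_inP => z zc; have [->|zy] := eqVneq z y.
      exact: lt_comparable.
    by apply: cx; rewrite !inE zy.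
  have zt z : z \in c -> (z == y) || (z < x).
    move=> zc; have [//|zy] := eqVneq z y.
    by rewrite (le_lt_trans _ tx) // tmax // !inE zy.
  split=> //; first by apply/negP => /zt; rewrite ltxx orbF (lt_eqF xy).
  apply/forall_inP => z /zt/orP[/eqP ->|zx]; first exact: lt_comparable.
  by rewrite comparable_sym lt_comparable.
have tr := rank_function_lt rankP ty.
apply: (@acyclic_belowW _ _ _ (((rank t).+1 - #|c :\ y|) + (rank y - rank t).-1)).
  by rewrite cm cD; lia.
apply: acyclic_below_join; first 2 last.
- exact: CohenMacaulay_interval.
- by move=> u v; rewrite !inE => /and3P[ut _ _] /andP[tv _]; apply: lt_trans tv.
exact: IHm.
Qed.

Definition chain_of u : {set P} := if u is Some v then (val v).1 else set0.

Lemma chain_of_elt c y : stell_pair (c, y) -> chain_of (elt c y) = c.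
Proof. by move=> cy; rewrite /stell_elt insubT. Qed.

Lemma above_eltP c y u : stell_pair (c, y) ->
  reflect (exists b z, [/\ u = elt b z, stell_pair (b, z), c \subset b, z <= y &
                         (c != b) || (y != z)])
    (u \in open_interval (elt c y) stell_top).
Proof.
move=> cy; rewrite inE; apply: (iffP andP) => [[]|[b [z [-> bz cb zy ne]]]].
  case: (stellP u) => [|b z bz]; first by rewrite ltxx.
  by rewrite stell_elt_lt // => /and3P[cb zy ne] _; exists b, z.
by rewrite stell_elt_lt // stell_elt_lt_top // cb zy.
Qed.

(** As y is in c, the second component cannot decrease any more, and an element of
    the interval is c together with a nonempty chain of gaps. *)
Lemma acyclic_above_top c y : stell_pair (c, y) -> y \in c ->
  acyclic_below ((rank y).+1 - #|c|) (open_interval (elt c y) stell_top).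
Proof.
move=> cy yc; have [cc c0 cley] := stell_pairP _ _ cy.
have gc x : x \in gaps c y -> x \notin c by rewrite inE => /and3P[].
have pairU f : face (gaps c y) f -> stell_pair (c :|: f, y).
  move=> /andP[/subsetP fg cf]; apply/stell_pairP; split.
  - apply/chainP => u v /setUP[] uc /setUP[] vc.
    + exact: (chainP _ cc).
    + have := fg v vc; rewrite inE comparable_sym => /and3P[_ _ /forall_inP]; exact.
    + have := fg u uc; rewrite inE => /and3P[_ _ /forall_inP]; exact.
    + exact: (chainP _ cf).
  - by rewrite inE c0.
  - by move=> x /setUP[/cley //|/fg]; rewrite inE => /and3P[/ltW].
have -> : open_interval (elt c y) stell_top =
    (fun f => elt (c :|: f) y) @: subdivision (gaps c y).
  apply/setP => u; apply/(above_eltP _ cy)/imsetP.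
    move=> [b [z [-> bz cb zy ne]]]; have [cb' _ lez] := stell_pairP _ _ bz.
    have e : z = y by apply: le_anti; rewrite zy lez // (subsetP cb).
    rewrite e eqxx orbF in ne; rewrite {z zy}e in bz lez *.
    exists (b :\: c); last by rewrite -{1}(setIidPr cb) setID.
    rewrite inE setD_eq0 /face (chain_sub (subsetDl b c) cb') andbT; apply/andP; split.
      by apply: contraNN ne => bc; rewrite eqEsubset cb.
    apply/subsetP => x; rewrite !inE => /andP[xc xb]; rewrite lt_neqAle lez // xc !andbT.
    apply/andP; split; first by apply: contraNneq xc => ->.
    by apply/forall_inP => w /(subsetP cb) wb; apply: (chainP _ cb').
  move=> [f]; rewrite inE => /andP[f0 ff] ->; exists (c :|: f), y.
  rewrite subsetUl lexx eqxx orbF; split=> //; first exact: pairU.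
  have [x xf] := set0Pn _ f0; have [fg _] := andP ff.
  have := gc x (subsetP fg _ xf); apply: contraNneq => ->.
  by rewrite inE xf orbT.
apply: acyclic_below_iso.
  move=> f f'; rewrite !inE => /andP[_ ff] /andP[_ ff'].
  rewrite stell_elt_le ?pairU // lexx andbT le_set subUset subsetUl /=.
  apply/idP/idP => [/subsetP s|s]; last exact: subset_trans s (subsetUr _ _).
  apply/subsetP => x xf; have := s x xf; rewrite inE => /orP[xc|//].
  by have [fg _] := andP ff; have := gc x (subsetP fg _ xf); rewrite xc.
apply: acyclic_below_subdivision; apply: acyclic_gaps => //.
exact/is_topP.
Qed.

Definition above_avoiding c y := [set u in open_interval (elt c y) stell_top | y \notin chain_of u].

(** The elements (c, z) with z < y have a largest one, (c, max c), so they form an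
    acyclic part.  Any other element is (b, z) with b strictly larger than c.  If
    z < y, the largest element of the acyclic part below it is (c, z).  If z = y,
    what lies above it is the same kind of set for the longer chain b, which is
    acyclic by induction. *)
Lemma acyclic_above_avoiding c y : stell_pair (c, y) -> y \notin c ->
  acyclic (above_avoiding c y).
Proof.
move: {2}#|~: c| (leqnn #|~: c|) => m; elim: m c => [|m IHm] c cm cy yc.
  have : y \in ~: c by rewrite inE.
  by move: cm; rewrite leqn0 cards_eq0 => /eqP ->; rewrite inE.
have [cc c0 cley] := stell_pairP _ _ cy.
have [t [tt _]] := chain_top cc c0; have [tc tmax] := is_topP _ _ tt.
have ty : t < y by rewrite lt_neqAle cley // andbT; apply: contraNneq yc => <-.
have lowP z : t <= z -> stell_pair (c, z).
  by move=> tz; apply/stell_pairP; split=> // x /tmax xt; apply: le_trans xt tz.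
have lowJ z : t <= z -> z < y -> elt c z \in above_avoiding c y.
  move=> tz zy; have cz := lowP z tz; rewrite inE chain_of_elt // yc andbT.
  by apply/(above_eltP _ cy); exists c, z; rewrite (gt_eqF zy) orbT ltW.
move=> n; apply: (proj1 (delete_ascending
  (A := [set u in above_avoiding c y | chain_of u == c]) _ _ n)).
- by apply/subsetP => u; rewrite inE => /andP[].
- move=> u; rewrite in_setD inE => /andP[nc uJ]; rewrite uJ /= in nc.
  move: (uJ); rewrite inE => /andP[/(above_eltP _ cy)[b [z [eu bz cb zy ne]]]].
  rewrite eu chain_of_elt // in nc * => yb.
  have bc : c != b by rewrite eq_sym.
  have [_ _ lez] := stell_pairP _ _ bz.
  have [ezy|nzy] := eqVneq z y; [left|right].
    rewrite ezy in bz *; have -> : above (above_avoiding c y) (elt b y) = above_avoiding b y.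
      apply/setP => w; rewrite !inE; have [bw|] := boolP (elt b y < w); last by rewrite andbF.
      by rewrite andbT (lt_trans _ bw) // stell_elt_lt // cb lexx bc.
    apply: IHm => //; rewrite -ltnS; apply: leq_trans cm; apply: proper_card.
    by rewrite properC properEneq bc.
  have tz : t <= z by apply: lez; apply: (subsetP cb).
  have cz := lowP z tz.
  have zy' : z < y by rewrite lt_neqAle nzy.
  apply: (@acyclic_max _ _ _ (elt c z)).
    rewrite inE in_set lowJ // chain_of_elt // eqxx /=.
    by rewrite stell_elt_lt // cb lexx bc.
  move=> w; rewrite inE in_set => /andP[/andP[wJ /eqP wc] /ltW].
  move: wJ wc; rewrite inE => /andP[/(above_eltP _ cy)[b1 [z1 [-> bz1 _ _ _]]] _].
  rewrite chain_of_elt // => e; rewrite e in bz1 *.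
  by rewrite !stell_elt_le // subxx cb.
apply: (@acyclic_max _ _ _ (elt c t)).
  by rewrite inE lowJ //= chain_of_elt // lowP.
move=> w; rewrite in_set => /andP[wJ /eqP wc].
move: wJ wc; rewrite inE => /andP[/(above_eltP _ cy)[b1 [z1 [-> bz1 _ _ _]]] _].
rewrite chain_of_elt // => e; rewrite e in bz1 *.
rewrite stell_elt_le ?(lowP _ (lexx t)) // subxx /=.
by have [_ _ ->] := stell_pairP _ _ bz1.
Qed.

(** If y is not in c, let p be the element (y |: c, y).  Every other element u
    whose chain contains y has a largest element below it among those avoiding y,
    obtained by dropping y.  So the interval without p is as acyclic as
    [above_avoiding], and what lies above p is treated in [acyclic_above_top]. *)
Lemma acyclic_above c y : stell_pair (c, y) ->
  acyclic_below ((rank y).+1 - #|c|) (open_interval (elt c y) stell_top).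
Proof.
move=> cy; have [yc|yc] := boolP (y \in c); first exact: acyclic_above_top.
have [cc c0 cley] := stell_pairP _ _ cy.
have py : stell_pair (y |: c, y).
  by apply: stell_pair_add => //; apply: stell_pair_comparable.
set J := open_interval _ _; set p := elt (y |: c) y.
have cNy : c != y |: c by apply: contraNneq yc => ->; rewrite setU11.
have pJ : p \in J.
  by apply/(above_eltP _ cy); exists (y |: c), y; rewrite subsetUr cNy.
case e: ((rank y).+1 - #|c|)%N => [|n]; first exact: acyclic_below0.
have acp : acyclic_below n (above J p).
  have -> : above J p = open_interval p stell_top.
    apply/setP => u; rewrite !inE andbC; have [pu|//] := boolP (p < u).
    by move: pJ; rewrite inE => /andP[sp _]; rewrite (lt_trans sp pu).
  have -> : n = ((rank y).+1 - #|y |: c|)%N by rewrite cardsU1 yc; move: e; lia.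
  by apply: acyclic_above_top => //; rewrite setU11.
apply: (acyclic_below_delete_min pJ _ _ acp).
  move=> u /(above_eltP _ cy)[b [z [-> bz cb zy ne]]].
  rewrite stell_elt_lt //; apply/negP => /and3P[byc yz ne'].
  have e1 : z = y by apply: le_anti; rewrite zy.
  rewrite e1 eqxx /= ?orbF in ne ne'.
  have yb : y \notin b.
    by apply: contraNN ne' => yb; rewrite eqEsubset byc subUset sub1set yb cb.
  move: ne; rewrite eqEsubset cb /= => /negP; apply; apply/subsetP => x xb.
  have := subsetP byc x xb; rewrite !inE => /orP[/eqP ex|//].
  by rewrite -ex xb in yb.
move=> m; apply: (proj1 (delete_ascending (A := above_avoiding c y) _ _ m)).
- apply/subsetP => u; rewrite in_set => /andP[uJ yu].
  rewrite in_setD1 uJ andbT; apply: contraNneq yu => ->.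
  by rewrite chain_of_elt // setU11.
- move=> u; rewrite in_setD in_setD1 => /andP[nA /andP[up uJ]]; right.
  rewrite in_set uJ /= negbK in nA; move: up nA uJ.
  move=> up nA /(above_eltP _ cy)[b [z [eu bz cb zy ne]]].
  rewrite {u}eu chain_of_elt // in up nA *.
  have [_ b0 lez] := stell_pairP _ _ bz.
  have e1 : z = y by apply: le_anti; rewrite zy lez.
  rewrite {z zy}e1 in bz up ne lez *.
  have bx : \bot \in b :\ y.
    by rewrite !inE b0 andbT; apply: contraNneq yc => <-.
  have vP : stell_pair (b :\ y, y) by apply: stell_pair_sub bz (subD1set _ _) bx _.
  apply: (@acyclic_max _ _ _ (elt (b :\ y) y)).
    rewrite inE in_set chain_of_elt // !inE eqxx /= andbT.
    rewrite !stell_elt_lt // stell_elt_lt_top // subsetD1 cb yc lexx subD1set eqxx !orbF /= andbT.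
    apply/andP; split; last by apply: contraTneq nA => <-; rewrite !inE eqxx.
    by apply: contraNneq up => ec; rewrite /p ec setD1K.
  move=> w; rewrite inE in_set => /andP[/andP[wJ wy] /ltW].
  move: wJ wy => /(above_eltP _ cy)[b1 [z1 [-> bz1 _ _ _]]].
  by rewrite chain_of_elt // !stell_elt_le // subsetD1 => -> /andP[-> ->].
exact: acyclic_above_avoiding.
Qed.

Lemma CohenMacaulay_stell : CohenMacaulay (Stell P).
Proof.
apply: (CohenMacaulay_criterion (stell_rank_function gradedP)) => s t.
case: (stellP s) => [/lt_geF|c y cy]; first by rewrite stell_le_top.
have cgt0 := card_stell_pair cy; have yn := rank_function_le rankP (lex1 y).
rewrite stell_rank_elt //; case: (stellP t) => [_|c' y' cy' lt].
  have := acyclic_above cy; congr acyclic_below; rewrite /=.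
  have arith (k r n : nat) : (0 < k)%N -> (r <= n)%N ->
    (r.+1 - k = (n.+1 - (k.-1 + (n - r))).-1)%N by lia.
  exact: arith.
have := lt; rewrite stell_elt_lt // => /and3P[sc yy' _].
rewrite stell_rank_elt //; have := acyclic_pair gradedP cmP cy cy' sc yy'.
congr acyclic_below; rewrite cardsD (setIidPr sc).
have arith (k k' r r' n : nat) : (0 < k)%N -> (k <= k')%N -> (r' <= r)%N ->
  (r <= n)%N ->
  ((k' - k + (r - r')).-1 = (k'.-1 + (n - r') - (k.-1 + (n - r))).-1)%N by lia.
by apply: arith => //; [apply: subset_leq_card | apply: rank_function_le].
Qed.

End StellUpper.

Theorem theorem1p2 (d : Order.disp_t) (P : finTBPOrderType d)
    (gradedP : graded P) :
  [/\ Eulerian P -> Eulerian (Stell P),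
      CohenMacaulay P -> CohenMacaulay (Stell P) &
      Gorenstein_star P -> Gorenstein_star (Stell P)].
Proof.
split; first exact: Eulerian_stell.
  exact: CohenMacaulay_stell.
by case=> eP cP; split; [apply: Eulerian_stell | apply: CohenMacaulay_stell].
Qed.
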